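(* Let $\sigma>0$, $k>0$, $L\ge2$. The process ABEP$(\sigma,k)$ on $\Lambda_L=\{1,\dots,L\}$ with closed boundary conditions is dual to the process SIP$(k)$ on $\Lambda_L$ with closed boundary conditions, with duality function $$D^\sigma_{(L)}(x,\xi)=\prod_{i=1}^L\frac{\Gamma(2k)}{\Gamma(2k+\xi_i)}\left(\frac{e^{-2\sigma E_{i+1}(x)}-e^{-2\sigma E_i(x)}}{2\sigma}\right)^{\xi_i},\qquad x\in[0,\infty)^L,\ \xi\in\mathbb N^{\Lambda_L},$$ where $E_i(x)=\sum_{\ell=i}^L x_\ell$ for $1\le i\le L$ and $E_{L+1}(x)=0$. That is, for all $x\in[0,\infty)^L$, $\xi\in\mathbb N^{\Lambda_L}$, $t>0$, $$\mathbb E_x\big[D^\sigma_{(L)}(x(t),\xi)\big]=\mathbb E_\xi\big[D^\sigma_{(L)}(x,\xi(t))\big],$$ where $x(t)$ is ABEP$(\sigma,k)$ started from $x$ and $\xi(t)$ is SIP$(k)$ started from $\xi$.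
   Context: $\mathbb N=\{0,1,2,\dots\}$. ABEP$(\sigma,k)$ on $\Lambda_L$ with closed boundary conditions is the Markov diffusion process on $[0,\infty)^L$ whose generator acts on the core of smooth functions as $\sum_{i=1}^{L-1}\mathcal L^{ABEP}_{i,i+1}$, $$\mathcal L^{ABEP}_{i,i+1}f(x)=\tfrac1{4\sigma^2}(1-e^{-2\sigma x_i})(e^{2\sigma x_{i+1}}-1)\Big(\tfrac{\partial}{\partial x_i}-\tfrac{\partial}{\partial x_{i+1}}\Big)^2f(x)-\tfrac1{2\sigma}\Big\{(1-e^{-2\sigma x_i})(e^{2\sigma x_{i+1}}-1)+2k\big(2-e^{-2\sigma x_i}-e^{2\sigma x_{i+1}}\big)\Big\}\Big(\tfrac{\partial}{\partial x_i}-\tfrac{\partial}{\partial x_{i+1}}\Big)f(x).$$ SIP$(k)$ on $\Lambda_L$ with closed boundary conditions is the Markov jump process on $\mathbb N^{\Lambda_L}$ with generator $$\sum_{i=1}^{L-1}\Big[\xi_i(2k+\xi_{i+1})\big(f(\xi^{i,i+1})-f(\xi)\big)+\xi_{i+1}(2k+\xi_i)\big(f(\xi^{i+1,i})-f(\xi)\big)\Big],$$ where $\xi^{i,j}$ is obtained from $\xi$ by moving one particle from site $i$ to site $j$. *)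

(* Defs.v *)
From HB Require Import structures.
From mathcomp Require Import all_boot all_order all_algebra.
From mathcomp Require Import all_classical all_reals all_analysis.
From mathcomp Require Import measurable_realfun.

Set Implicit Arguments.
Unset Strict Implicit.
Unset Printing Implicit Defensive.

Import Order.TTheory GRing.Theory Num.Theory.
Import numFieldNormedType.Exports.

Local Open Scope classical_set_scope.
Local Open Scope ring_scope.

(** Conventions.  Sites are numbered 0, ..., L-1 instead of 1, ..., L.  An
    energy configuration is a row vector x : 'rV[R]_L with nonnegative entries
    [x 0 i], and a particle configuration is a row vector xi : 'rV[nat]_L. *)

(** * Markov processes *)

Section MarkovProcess.
Context {R : realType} {T : ptopologicalType}.
Context {d : measure_display} {Omega : measurableType d}.
Variables (S : set T) (X : R -> Omega -> T) (P : T -> probability Omega R).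

Definition borel_set : set (set T) := <<s (@open T) >>.

Definition past (s : R) : set (set Omega) :=
  <<s [set A | exists u B,
         [/\ 0 <= u <= s, borel_set B & A = X u @^-1` B] ] >>.

(** [X] is a time-homogeneous Markov process on the state space [S], a subset
    of the ambient space [T]; [P x] is the law of the process started from [x].
    Only nonnegative times and starting points in [S] are relevant. *)
Record markov_process : Prop := MarkovProcess {
  markov_state : forall (t : R) w, 0 <= t -> S (X t w);
  markov_measurable : forall (t : R) B,
    0 <= t -> borel_set B -> measurable (X t @^-1` B);
  markov_start : forall x, S x -> P x (X 0 @^-1` [set x]) = 1%E;
  markov_kernel : forall (t : R) B, 0 <= t -> borel_set B ->
    measurable_fun (S : set (g_sigma_algebraType (@open T)))
      (fun x => P x (X t @^-1` B) : \bar R);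
  markov_property : forall x (s t : R) A B,
    S x -> 0 <= s -> 0 <= t -> past s A -> borel_set B ->
    P x (A `&` X (s + t) @^-1` B) =
    (\int[P x]_(w in A) P (X s w) (X t @^-1` B))%E
}.

Definition semigroup (t : R) (f : T -> R) (x : T) : R :=
  fine 'E_(P x)[fun w => f (X t w)]%E.

Definition difference_quotient (f : T -> R) (h : R) (x : T) : R :=
  (semigroup h f x - f x) / h.

(** Functions on [S] are represented by functions on [T], whose values outside
    [S] are irrelevant. *)
Definition C0 (f : T -> R) : Prop :=
  {within S, continuous f} /\
  forall e : R, 0 < e -> exists K, [/\ compact K, K `<=` S &
    forall x, S x -> ~ K x -> `|f x| < e].

Record feller : Prop := Feller {
  feller_C0 : forall (t : R) f, 0 <= t -> C0 f -> C0 (semigroup t f);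
  feller_continuous : forall f, C0 f ->
    {uniform S, (fun t => semigroup t f) @ 0^'+ --> f}
}.

(** [generator f g] : [f] is in the domain of the infinitesimal generator of
    the semigroup on [C0] (with the supremum norm), which maps [f] to [g]. *)
Definition generator (f g : T -> R) : Prop :=
  [/\ C0 f, C0 g & {uniform S, difference_quotient f @ 0^'+ --> g}].

(** The generator acts as [A] on [D], and [D] is a core: the generator is the
    closure of its restriction to [D]. *)
Definition generator_on_core (D : set (T -> R)) (A : (T -> R) -> T -> R) :
    Prop :=
  (forall f, D f -> generator f (A f)) /\
  (forall f g, generator f g -> forall e : R, 0 < e -> exists2 f', D f' &
     forall x, S x -> `|f x - f' x| < e /\ `|g x - A f' x| < e).

Definition continuous_paths : Prop :=
  forall x, S x ->
    {ae P x, forall w, {within `[0, +oo[, continuous (fun t => X t w)}}.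

(** When [T] is discrete, such paths are piecewise constant, with finitely many
    jumps in every bounded time interval. *)
Definition cadlag_paths : Prop :=
  forall x, S x -> {ae P x, forall w,
    (forall t : R, 0 <= t -> X s w @[s --> t^'+] --> X t w) /\
    (forall t : R, 0 < t -> exists l : T, X s w @[s --> t^'-] --> l)}.

End MarkovProcess.

(** * The process ABEP *)

Section ABEP.
Context {R : realType} {L : nat}.
Implicit Types (f : 'rV[R]_L -> R) (x : 'rV[R]_L) (i j : 'I_L).

Definition orthant : set 'rV[R]_L := [set x | forall i, 0 <= x 0 i].

Definition partial i f : 'rV[R]_L -> R := fun x => 'D_(delta_mx 0 i) f x.

Definition smooth f : Prop := forall s : seq 'I_L,
  continuous (foldr partial f s) /\
  forall i x, derivable (foldr partial f s) x (delta_mx 0 i).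

(** Up to values outside the orthant: the compactly supported functions on
    [0, oo)^L that are smooth up to the boundary. *)
Definition test_function : set ('rV[R]_L -> R) :=
  [set f | smooth f /\ exists K, [/\ compact K, K `<=` orthant &
    forall x, orthant x -> ~ K x -> f x = 0]].

Definition partial_diff i j f : 'rV[R]_L -> R :=
  fun x => partial i f x - partial j f x.

Definition ABEP_bond (sigma k : R) i j f x : R :=
  let a := expR (- (2 * sigma * x 0 i)) in
  let b := expR (2 * sigma * x 0 j) in
  1 / (4 * sigma ^+ 2) * ((1 - a) * (b - 1)) *
    partial_diff i j (partial_diff i j f) x
  - 1 / (2 * sigma) * ((1 - a) * (b - 1) + 2 * k * (2 - a - b)) *
    partial_diff i j f x.

Definition ABEP_operator (sigma k : R) f x : R :=
  \sum_(i < L) \sum_(j < L | j == i.+1 :> nat) ABEP_bond sigma k i j f x.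

Definition is_ABEP (sigma k : R) {d} {Omega : measurableType d}
    (X : R -> Omega -> 'rV[R]_L) (P : 'rV[R]_L -> probability Omega R) : Prop :=
  [/\ markov_process orthant X P, continuous_paths orthant X P,
      feller orthant X P &
      generator_on_core orthant X P test_function (ABEP_operator sigma k)].

End ABEP.

(** * The process SIP *)

Section SIP.
Context {R : realType} {L : nat}.
Implicit Types (f : 'rV[nat]_L -> R) (xi : 'rV[nat]_L) (i j : 'I_L).

(** For [xi 0 i = 0] the subtraction is truncated, but then the rate of the
    move in [SIP_operator] is zero. *)
Definition move xi i j : 'rV[nat]_L :=
  \row_l (xi ord0 l - (l == i) + (l == j))%N.

Definition SIP_bond (k : R) i j f xi : R :=
  (xi 0 i)%:R * (2 * k + (xi 0 j)%:R) * (f (move xi i j) - f xi) +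
  (xi 0 j)%:R * (2 * k + (xi 0 i)%:R) * (f (move xi j i) - f xi).

Definition SIP_operator (k : R) f xi : R :=
  \sum_(i < L) \sum_(j < L | j == i.+1 :> nat) SIP_bond k i j f xi.

(** The topology of 'rV[nat]_L is discrete.  The jump rates are unbounded, so
    the generator acts on bounded functions pointwise. *)
Definition is_SIP (k : R) {d} {Omega : measurableType d}
    (Y : R -> Omega -> 'rV[nat]_L) (Q : 'rV[nat]_L -> probability Omega R) :
    Prop :=
  [/\ markov_process setT Y Q, cadlag_paths setT Y Q &
      forall f, (exists M : R, forall xi, `|f xi| <= M) ->
        forall xi, difference_quotient Y Q f h xi @[h --> 0^'+] -->
                   SIP_operator k f xi].

End SIP.

(** * The duality function *)

Section Duality.
Context {R : realType}.

Definition Gamma (z : R) : R :=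
  \int[lebesgue_measure]_(t in `]0, +oo[) (t `^ (z - 1) * expR (- t)).

(** [tail_energy x i.+1] is the energy strictly to the right of [i]; it is zero
    for the last site. *)
Definition tail_energy {L : nat} (x : 'rV[R]_L) (m : nat) : R :=
  \sum_(l < L | (m <= l)%N) x 0 l.

Definition duality_function (sigma k : R) {L : nat}
    (x : 'rV[R]_L) (xi : 'rV[nat]_L) : R :=
  \prod_(i < L)
    (Gamma (2 * k) / Gamma (2 * k + (xi 0 i)%:R) *
     ((expR (- (2 * sigma * tail_energy x i.+1)) -
       expR (- (2 * sigma * tail_energy x i))) / (2 * sigma)) ^+ xi 0 i).

End Duality.

(* Main.v *)
(** Total energy is invariant under ABEP, so multiplying a duality function
    [D(., xi)] by [exp (- 1 / (M - E))], where [E] is the total energy, gives a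
    function [f_xi] that is smooth with compact support and on which the ABEP
    generator still acts through the SIP generator in [xi].  By the Markov
    property, [t |-> E_x f_xi(x(t))], with [xi] ranging over the configurations
    of [n] particles, solves the linear equation [u' = SIP u]; so does
    [exp (- 1 / (M - E(x)))] times [t |-> E_xi D(x, xi(t))].  On a fixed number
    of particles the SIP rates are bounded, hence the two solutions agree.
    Uniqueness also shows that SIP preserves the number of particles.  The case
    [xi = 0] says that [E_x exp (- 1 / (M - E(x(t))))] is constant in [t], which
    controls the error made when [M] tends to infinity. *)
Require Import Defs.
From HB Require Import structures.
From mathcomp Require Import all_boot all_order all_algebra.
From mathcomp Require Import all_classical all_reals all_analysis.
From mathcomp Require Import measurable_realfun.
From mathcomp Require Import giry ring lra.

Set Implicit Arguments.
Unset Strict Implicit.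
Unset Printing Implicit Defensive.

Import Order.TTheory GRing.Theory Num.Theory.
Import numFieldNormedType.Exports.

Local Open Scope classical_set_scope.
Local Open Scope ring_scope.

(** * Right derivatives and linear differential equations *)

Section RightDerivative.
Context {R : realType}.
Implicit Types (g : R -> R) (t : R).

(** The duality function does not vanish at infinity on the orthant, so it lies outside the domain
    of the Feller generator; this forces the cut-off. The total energy is the quantity to cut off
    because every bond derivative d_i - d_j annihilates it, so the cut-off is a constant for the
    ABEP operator. The two generators are used differently. The SIP generator acts on every bounded
    function, so the backward equation is available: the operator is applied to the evolved
    function. On the ABEP side the evolved function need not be a test function, so the forward
    equation is used: the operator is applied to the test function under the expectation, and the
    intertwining turns the result into a finite combination of expectations. Either way one obtains
    a right derivative and left continuity only, and uniqueness is proved under just these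
    hypotheses. *)

Definition right_derivative g t (l : R) : Prop :=
  (g (t + h) - g t) / h @[h --> 0^'+] --> l.

Definition left_continuous g t : Prop := g (t - h) @[h --> 0^'+] --> g t.

Lemma near_right0P (P : R -> Prop) :
  (\forall h \near 0^'+, P h) <->
  exists2 e : R, 0 < e & forall h, 0 < h < e -> P h.
Proof.
split.
  move=> [e /= e0 He]; exists e => // h /andP[h0 he].
  by apply: He => //=; rewrite sub0r normrN gtr0_norm.
move=> [e e0 He]; exists e => //= h /=; rewrite sub0r normrN => he h0.
by apply: He; rewrite h0 (le_lt_trans (ler_norm _) he).
Qed.

Lemma right_derivativeB g1 g2 t l1 l2 :
  right_derivative g1 t l1 -> right_derivative g2 t l2 ->
  right_derivative (fun s => g1 s - g2 s) t (l1 - l2).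
Proof.
rewrite /right_derivative => h1 h2; apply: (cvg_trans _ (cvgB h1 h2)).
by apply: near_eq_cvg; near=> h => /=; rewrite !fctE /=; ring.
Unshelve. all: by end_near. Qed.

Lemma right_derivativeZ c g t l :
  right_derivative g t l -> right_derivative (fun s => c * g s) t (c * l).
Proof.
rewrite /right_derivative => h1; apply: (cvg_trans _ (cvgM (cvg_cst c) h1)).
by apply: near_eq_cvg; near=> h => /=; ring.
Unshelve. all: by end_near. Qed.

Lemma is_derive_right g t l : is_derive t 1 g l -> right_derivative g t l.
Proof.
move=> [/cvg_ex[/= m gm] <-].
have -> : 'D_1 g t = m by apply/cvg_lim.
rewrite /right_derivative; apply: (cvg_trans _ (cvg_dnbhs_at_right gm));
  apply: near_eq_cvg; near=> h => /=.
by rewrite /= [h%:A]mulr1 [h + t]addrC mulrC.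
Unshelve. all: by end_near. Qed.

Lemma left_continuousB g1 g2 t :
  left_continuous g1 t -> left_continuous g2 t ->
  left_continuous (fun s => g1 s - g2 s) t.
Proof. exact: cvgB. Qed.

Lemma left_continuousZ c g t :
  left_continuous g t -> left_continuous (fun s => c * g s) t.
Proof. exact: cvgMl_tmp. Qed.

Lemma continuous_left_continuous g t :
  {for t, continuous g} -> left_continuous g t.
Proof.
move=> gt; apply: (cvg_comp (fun h => t - h) g _ gt).
suff : t - h @[h --> 0^'+] --> t - 0 by rewrite subr0.
by apply: cvgB; [exact: cvg_cst|exact: cvg_at_right_filter].
Qed.

(** With one-sided derivatives the mean value theorem is replaced by a supremum argument. After
    subtracting a line of slope [r > 0], let [c] be the last time in [[0, T]] at which the function
    is nonpositive: left continuity puts [c] itself in this set, and a negative right derivative at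
    [c] would extend the set beyond [c] if [c < T]. *)
Lemma right_derivative_nonincreasing g d :
  (forall t, 0 <= t -> right_derivative g t (d t)) ->
  (forall t, 0 <= t -> d t <= 0) ->
  (forall t, 0 < t -> left_continuous g t) ->
  forall t, 0 <= t -> g t <= g 0.
Proof.
move=> dg d0 cg T T0; apply/ler_addgt0Pr => e e0.
(* The denominator [T + 1] gives [r * T <= e] and is positive also when [T = 0]. *)
set r := e / (T + 1).
have T1 : 0 < T + 1 by apply: ltr_wpDl.
have r0 : 0 < r by rewrite divr_gt0.
suff : g T - g 0 - r * T <= 0.
  rewrite !subr_le0 lerBlDl => /le_trans; apply; rewrite lerD2l /r.
  by rewrite -mulrA ger_pMr// mulrC ler_pdivrMr// mul1r lerDl.
pose k s := g s - g 0 - r * s.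
rewrite -/(k T) leNgt; apply/negP => kT.
pose A := [set s | 0 <= s <= T /\ k s <= 0].
have A0 : A 0 by split; rewrite ?lexx// /k mulr0; lra.
have hA : has_sup A by split; [exists 0|exists T => s [/andP[]]].
set c := sup A.
have c0 : 0 <= c by apply: sup_upper_bound.
have cT : c <= T by apply: ge_sup; [exists 0|move=> s [/andP[]]].
have kc : k c <= 0.
  rewrite leNgt; apply/negP => kc.
  have {}c0 : 0 < c.
    rewrite lt_neqAle c0 andbT; apply/eqP => c0'.
    by move: kc; rewrite -c0' ltNge; case: A0 => _ ->.
  have kl : left_continuous k c.
    apply: left_continuousB; first by apply: left_continuousB;
      [exact: cg|exact: cvg_cst].
    by apply: left_continuousZ; apply: continuous_left_continuous;
      exact: cvg_id.
  have /near_right0P[eta eta0 H] : \forall h \near 0^'+, 0 < k (c - h).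
    exact: (cvgr_gt (k c) kl).
  have [s sA] := sup_adherent eta0 hA.
  rewrite -/c => cs; have sc : s <= c by apply: sup_upper_bound.
  case: sA => _; rewrite leNgt => /negP; apply.
  have [->//|sc'] := eqVneq s c.
  rewrite (_ : s = c - (c - s)); last by ring.
  by apply: H; rewrite subr_gt0 lt_neqAle sc' sc/=; lra.
have {}cT : c < T.
  by rewrite lt_neqAle cT andbT; apply/eqP => cT'; move: kc;
    rewrite cT' leNgt kT.
have : right_derivative k c (d c - 0 - r * 1).
  apply: right_derivativeB; first apply: right_derivativeB; first exact: dg.
    rewrite /right_derivative subrr; under eq_fun do rewrite mul0r;
      exact: cvg_cst.
  by apply: right_derivativeZ; apply: is_derive_right.
move=> /(cvgr_lt _)/(_ 0).
have dc : d c - 0 - r * 1 < 0 by have := d0 _ c0; lra.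
move=> /(_ dc)/near_right0P[eta eta0 H].
set h := Num.min (eta / 2) (T - c).
have h0 : 0 < h by rewrite lt_min subr_gt0 cT andbT divr_gt0.
have he : h < eta by rewrite (@le_lt_trans _ _ (eta / 2)) ?ge_min ?lexx//; lra.
have hT : h <= T - c by rewrite ge_min lexx orbT.
have := H h; rewrite h0 he => /(_ isT).
rewrite pmulr_llt0 ?invr_gt0// subr_lt0 => kch.
suff : c + h <= c by rewrite gerDl leNgt h0.
apply: sup_upper_bound => //; split; last exact/ltW/(lt_le_trans kch).
by apply/andP; split; lra.
Qed.

(** A bound [|z t| <= b * exp (2 * C * t)] integrates to the same bound with
    [b / 2], so it can be halved indefinitely. *)
Lemma bounded_linear_ode_unique (I : Type) (S : set I) (z d : I -> R -> R)
    (B C : R) : 0 <= B -> 0 < C ->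
  (forall i t, S i -> 0 <= t -> right_derivative (z i) t (d i t)) ->
  (forall i t, S i -> 0 < t -> left_continuous (z i) t) ->
  (forall i, S i -> z i 0 = 0) ->
  (forall i t, S i -> 0 <= t -> `|z i t| <= B) ->
  (forall t b, 0 <= t -> (forall i, S i -> `|z i t| <= b) ->
    forall i, S i -> `|d i t| <= C * b) ->
  forall i t, S i -> 0 <= t -> z i t = 0.
Proof.
move=> B0 C0 dz cz z0 zB dC.
(* The rate [2 * C] makes the derivative of [b / 2 * w] equal to [C * (b * w)], which is the bound
   on the derivative of [z] under the hypothesis that [z] is at most [b * w] in absolute value. *)
pose w t := expR (2 * C * t).
have dw t : is_derive t 1 w (2 * C * w t).
  rewrite /w.
  apply: is_derive_eq.
  rewrite /GRing.scale /=.
  ring.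
have w1 t : 0 <= t -> 1 <= w t.
  by move=> t0; rewrite -expR0 ler_expR !mulr_ge0// ltW.
have step b : 0 <= b -> (forall i t, S i -> 0 <= t -> `|z i t| <= b * w t) ->
  forall i t, S i -> 0 <= t -> `|z i t| <= b / 2 * w t.
  move=> b0 Hb i.
  (* The signs [s = 1] and [s = -1] turn the one-sided monotonicity lemma into a bound on the
     absolute value. *)
  have key (s : R) t : `|s| = 1 -> S i -> 0 <= t -> s * z i t <= b / 2 * w t.
    move=> s1 Si t0.
    have := @right_derivative_nonincreasing
      (fun t => s * z i t - b / 2 * w t) (fun t => s * d i t - b / 2 * (2 * C *
        w t)).
    rewrite z0// mulr0 sub0r => /(_ _ _ _ t t0) H.
    suff : s * z i t - b / 2 * w t <= - (b / 2 * w 0).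
      have : 0 <= b / 2 * w 0 by rewrite mulr_ge0 ?divr_ge0// expR_ge0.
      lra.
    apply: H => u u0.
    - apply: right_derivativeB; apply: right_derivativeZ; first exact: dz.
      exact: is_derive_right.
    - have := dC u (b * w u) u0 (fun i Si => Hb i u Si u0) i Si.
      have : s * d i u <= `|d i u| by rewrite (le_trans (ler_norm _))// normrM
        s1 mul1r.
      move=> /le_trans h /h; lra.
    - apply: left_continuousB; apply: left_continuousZ; first exact: cz.
      apply: continuous_left_continuous; apply: differentiable_continuous.
      by apply/derivable1_diffP; have [] := dw u.
  move=> t Si t0; rewrite ler_norml; apply/andP; split.
    by rewrite lerNl -mulN1r; apply: key; rewrite ?normrN1.
  by rewrite -[z i t]mul1r; apply: key; rewrite ?normr1.
have iterB n i t : S i -> 0 <= t -> `|z i t| <= B / 2 ^+ n * w t.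
  elim: n i t => [|n IH] i t Si t0.
    by rewrite expr0 divr1 (le_trans (zB _ _ Si t0))// ler_peMr// w1.
  rewrite exprSr invfM mulrA; apply: step => //.
  by rewrite divr_ge0// exprn_ge0.
move=> i t Si t0; apply/eqP; rewrite -normr_le0.
have : B / 2 ^+ n * w t @[n --> \oo] --> (0 : R).
  rewrite -[X in _ --> X](mul0r (w t)); apply: cvgM; last exact: cvg_cst.
  rewrite -[X in _ --> X](mulr0 B); apply: cvgM; first exact: cvg_cst.
  apply: (@cvg_trans _ ((1 / 2 : R) ^+ n @[n --> \oo])).
    by apply: near_eq_cvg; near=> n; rewrite expr_div_n expr1n div1r.
  by apply: cvg_expr; rewrite ger0_norm; lra.
move=> h0; apply: (cvgr_to_ge h0); near=> n; exact: iterB.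
Unshelve. all: by end_near. Qed.
End RightDerivative.

(** A single term of the exponential series bounds [expR x] from below. The estimate is used for
    large [x] in the boundary terms of the Gamma integral, and at [x = t^-1] to make the cut-off
    vanish at [0]. *)
Lemma pow_expRN_le {R : realType} (m : nat) (x : R) : 0 < x ->
  x ^+ m * expR (- x) <= m.+1`!%:R / x.
Proof.
move=> x0; rewrite expRN ler_pdivlMr// mulrAC -exprSr ler_pdivrMr ?expR_gt0//.
rewrite mulrC -ler_pdivrMr ?ltr0n ?fact_gt0//.
by apply: le_trans (expR_ge1Dxn m (ltW x0)); rewrite lerDr.
Qed.

(** * The recurrence of the Gamma function *)

Section GammaFunction.
Context {R : realType}.
Notation mu := (@lebesgue_measure R).

(** The shift by 2 keeps the interval nondegenerate for [n = 0], as integration by parts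
    requires. *)
Let itv n : set R := `[n.+2%:R^-1, n.+2%:R].

Let itv_lt n : n.+2%:R^-1 < n.+2%:R :> R.
Proof. by rewrite (@lt_trans _ _ 1) ?invf_lt1 ?ltr1n. Qed.

Let itv_gt0 n (x : R) : itv n x -> 0 < x.
Proof. by rewrite /itv /= in_itv/= => /andP[+ _]; apply: lt_le_trans. Qed.

Let itvU : \bigcup_n itv n = `]0, +oo[%classic.
Proof.
apply/seteqP; split => x.
  by move=> [n _ /itv_gt0]; rewrite /= in_itv/= andbT.
rewrite /= in_itv/= andbT => x0; exists (Num.trunc (x + x^-1)) => //.
have := truncnS_gt (x + x^-1).
set m := Num.trunc _ => xm; rewrite /itv /= in_itv/=.
have h : x + x^-1 <= m.+2%:R by rewrite (le_trans (ltW xm))// ler_nat.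
have x10 : 0 < x^-1 by rewrite invr_gt0.
apply/andP; split; last lra.
by rewrite -[leRHS]invrK lef_pV2 ?posrE//; lra.
Qed.

Let nditv : nondecreasing_seq itv.
Proof.
apply/nondecreasing_seqP => n; apply/subsetPset => x.
rewrite /itv /= !in_itv/= => /andP[nx xn]; apply/andP; split.
  by rewrite (le_trans _ nx)// lef_pV2 ?posrE// ler_nat.
by rewrite (le_trans xn)// ler_nat.
Qed.

Let f (p x : R) : R := x `^ p * expR (- x).

Let continuous_powR_itv p n : {within itv n, continuous (fun x : R => x `^ p)}.
Proof.
apply: derivable_within_continuous => x /itv_gt0 x0.
by apply: derivable_powR; rewrite in_itv/= andbT.
Qed.

Let continuous_expRN : continuous (fun x : R => expR (- x)).
Proof.
by move=> x; apply: continuous_comp; [exact: continuousN|exact: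
  continuous_expR].
Qed.

Let continuous_f p n : {within itv n, continuous (f p)}.
Proof.
move=> x; apply: cvgM; first exact: continuous_powR_itv.
by apply: continuous_subspaceT => ?; exact: continuous_expRN.
Qed.

Let integrable_f p n : mu.-integrable (itv n) (EFin \o f p).
Proof.
by apply: continuous_compact_integrable; [exact: segment_compact|exact:
  continuous_f].
Qed.

Let J p n := (\int[mu]_(x in itv n) (f p x)%:E)%E.

Let cvg_J p : J p n @[n --> \oo] --> (\int[mu]_(x in `]0%R, +oo[) (f p x)%:E)%E.
Proof.
rewrite -itvU; apply: ge0_nondecreasing_set_cvg_integral => //.
- by move=> n; exact: measurable_itv.
- by move=> n; have /integrableP[] := integrable_f p n.
- by move=> n x _; rewrite lee_fin mulr_ge0 ?powR_ge0 ?expR_ge0.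
Qed.

Let boundary z n : R := f z n.+2%:R - f z n.+2%:R^-1.

Let J_parts z n : (J z n + (boundary z n)%:E = z%:E * J (z - 1) n)%E.
Proof.
have fin p : J p n \is a fin_num.
  by apply: integrable_fin_num => //; [exact: measurable_itv|exact:
    integrable_f].
have n0 : 0 < n.+2%:R^-1 :> R by rewrite invr_gt0.
have dpow (x : R) : n.+2%:R^-1 <= x -> is_derive x 1 (fun x => x `^ z) (z * x
  `^ (z - 1)).
  by move=> nx; apply: is_derive1_powR; apply: lt_le_trans nx.
have dexp (x : R) : is_derive x 1 (fun x => expR (- x)) (- expR (- x)).
  by apply: is_derive_eq; rewrite /GRing.scale /=; ring.
have cts (h : R -> R) (x l : R) : is_derive x 1 h l -> {for x, continuous h}.
  by move=> [/derivable1_diffP/differentiable_continuous].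
have := @integration_by_parts R (fun x => x `^ z) (fun x => expR (- x))
  (fun x => z * x `^ (z - 1)) (fun x => - expR (- x)) _ _ (itv_lt n).
rewrite -/(itv n).
have -> : (\int[mu]_(x in itv n) (x `^ z * - expR (- x))%:E = - J z n)%E.
  rewrite /J -integralN; last first.
    by apply: integrable_add_def; [exact: measurable_itv|exact: integrable_f].
  by apply: eq_integral => x _; rewrite mulrN EFinN.
have -> : (\int[mu]_(x in itv n) (z * x `^ (z - 1) * expR (- x))%:E =
   z%:E * J (z - 1) n)%E.
  rewrite /J -integralZl; [|exact: measurable_itv|exact: integrable_f].
  by apply: eq_integral => x _; rewrite -EFinM /f mulrA.
have LR (h l : R -> R) : (forall x : R, n.+2%:R^-1 <= x -> is_derive x 1 h (l
  x)) ->
    derivable_oo_LRcontinuous h n.+2%:R^-1 n.+2%:R.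
  move=> dh; split.
  - by move=> x; rewrite in_itv/= => /andP[/ltW/dh[]].
  - by apply: cvg_at_right_filter; exact: cts (dh _ (lexx _)).
  - by apply: cvg_at_left_filter; exact: cts (dh _ (ltW (itv_lt n))).
rewrite -/(f z _) -/(f z _) -/(boundary z n) => H.
have {H} : (- J z n = (boundary z n)%:E - z%:E * J (z - 1) n)%E.
  apply: H.
  - by move=> x; apply: cvgM; [exact: cvg_cst|exact: continuous_powR_itv].
  - exact: LR dpow.
  - by move=> x; rewrite in_itv/= => /andP[/ltW/dpow + _] => -[_];
    rewrite derive1E.
  - by move=> x; apply: cvgN; apply: continuous_subspaceT => ?;
    exact: continuous_expRN.
  - exact: LR (fun x _ => dexp x).
  - by move=> x _; have [_] := dexp x; rewrite derive1E.
case: (J z n) (J (z - 1) n) (fin z) (fin (z - 1)) => [a| |] [b| |]// _ _.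
rewrite -EFinM -EFinN -EFinB => -[h].
by rewrite -EFinD; congr EFin; lra.
Qed.

Let cvg_boundary z : 0 < z -> boundary z n @[n --> \oo] --> (0 : R).
Proof.
move=> z0.
suff : boundary z n @[n --> \oo] --> (0 - 0 : R) by rewrite subr0.
have nV : (fun n => n.+2%:R^-1 : R) @ \oo --> (0 : R).
  have := @cvg_harmonic R; rewrite -(cvg_shiftS _); exact.
apply: cvgB.
  (* An integer exponent above [z], so that the bound for integer powers applies to the upper
     boundary term. *)
  set m := (Num.trunc z).+1.
  apply: (@squeeze_cvgr _ _ _ _ (fun=> 0) (fun n => m.+1`!%:R * n.+2%:R^-1)).
  - near=> n; rewrite /f mulr_ge0 ?powR_ge0 ?expR_ge0//=.
    apply: le_trans (pow_expRN_le m _); last by rewrite ltr0n.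
    rewrite ler_wpM2r ?expR_ge0// -powR_mulrn ?ler0n//.
    by apply: ler_powR; rewrite ?ler1n// ltW// truncnS_gt.
  - exact: cvg_cst.
  - by rewrite -[X in _ --> X](mulr0 m.+1`!%:R); apply: cvgM => //;
    exact: cvg_cst.
apply: (@squeeze_cvgr _ _ _ _ (fun=> 0) (fun n => n.+2%:R^-1 `^ z)).
- near=> n; rewrite /f mulr_ge0 ?powR_ge0 ?expR_ge0//=.
  by rewrite ler_piMr ?powR_ge0// expR_le1 oppr_le0 invr_ge0.
- exact: cvg_cst.
- by have /cvg_at_rightP := powR_cvg0 z0; apply; split.
Unshelve. all: by end_near. Qed.

(** Integration by parts on [itv n]; passing to the limit in the extended reals
    avoids proving that the integrals are finite, [fine] sending an infinite
    value to [0] on both sides. *)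
Lemma Gamma_recurrence (z : R) : 0 < z -> Gamma (z + 1) = z * Gamma z.
Proof.
move=> z0; rewrite /Gamma /Rintegral addrK.
set I1 := (\int[_]_(_ in _) _)%E; set I2 := (X in _ = z * fine X).
have H : (J z n + (boundary z n)%:E)%E @[n --> \oo] --> (I1 + 0%:E)%E.
  apply: cvgeD; [by rewrite fin_num_adde_defl|exact: cvg_J|].
  by apply: cvg_EFin; [exact: nearW|exact: cvg_boundary].
have H' : (z%:E * J (z - 1) n)%E @[n --> \oo] --> (z%:E * I2)%E.
  by apply: cvgeZl => //; exact: cvg_J.
have : (I1 + 0%:E = z%:E * I2)%E.
  by apply: (cvg_unique _ H) => //; rewrite /= (eq_cvg _ _ (J_parts z)).
rewrite adde0 => ->.
have [/fineK <-|] := boolP (I2 \is a fin_num); first by rewrite -EFinM.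
rewrite ge0_fin_numE; last by apply: integral_ge0 => x _;
  rewrite lee_fin mulr_ge0 ?powR_ge0 ?expR_ge0.
by rewrite -leNgt leye_eq => /eqP ->; rewrite gt0_muley ?lte_fin//= mulr0.
Qed.

End GammaFunction.

(** * Smooth cut-offs of the energy *)

Section Bump.
Context {R : realType}.

(** [bump 0] is the standard smooth function vanishing on the negative
    half-line; the span of the [bump m] is closed under derivation. *)
Definition bump (m : nat) (t : R) : R :=
  if 0 < t then t^-1 ^+ m * expR (- t^-1) else 0.

Lemma bump_ge0 m t : 0 <= bump m t.
Proof.
rewrite /bump; case: ifPn => // t0.
by rewrite mulr_ge0 ?expR_ge0// exprn_ge0// invr_ge0 ltW.
Qed.

Lemma bump0_le1 t : bump 0 t <= 1.
Proof.
rewrite /bump; case: ifPn => // t0.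
by rewrite expr0 mul1r expR_le1 oppr_le0 invr_ge0 ltW.
Qed.

Lemma bump_le m (t : R) : 0 < t -> bump m t <= m.+1`!%:R * t.
Proof.
move=> t0; rewrite /bump t0.
by have := @pow_expRN_le R m t^-1; rewrite invr_gt0 invrK; exact.
Qed.

(** For [t > 0] this is the chain rule for [u ^+ m * expR (- u)] at [u = t^-1]. At [0] the
    difference quotient [bump m h / h] is [bump m.+1 h] for [h > 0], which is of order [h] by
    [bump_le], and it is zero for [h < 0]. *)
Lemma is_derive_bump m (t : R) :
  is_derive t 1 (bump m) (bump m.+2 t - m%:R * bump m.+1 t).
Proof.
have [t0|t0|->] := ltrgt0P t.
- pose g (t : R) := t^-1 ^+ m * expR (- t^-1).
  have tN0 : t != 0 by rewrite gt_eqF.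
  have dV : is_derive t 1 (fun t : R => t^-1) (- t^-1 ^+ 2).
    by have := is_deriveV tN0 (is_derive_id t (1 : R));
      rewrite exprVn [_ *: _]mulr1.
  have dg : is_derive t 1 g (bump m.+2 t - m%:R * bump m.+1 t).
    have dG (u : R) : is_derive u 1 (fun u => u ^+ m * expR (- u))
        (m%:R * u ^+ m.-1 * expR (- u) - u ^+ m * expR (- u)).
      have dm : is_derive u 1 (fun u => u ^+ m) (m%:R * u ^+ m.-1).
        apply: DeriveDef; first exact: exprn_derivable.
        by rewrite exp_derive /GRing.scale/= mulr1.
      have de : is_derive u 1 (fun u => expR (- u)) (- expR (- u)).
        by apply: is_derive_eq; rewrite /GRing.scale/=; ring.
      by apply: (is_derive_eq (is_deriveM dm de)); rewrite /GRing.scale/=; ring.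
    apply: (is_derive_eq (is_derive1_comp (dG t^-1) dV)).
    rewrite /bump t0; case: m {g dG} => [|n]; rewrite /= ?exprS; ring.
  apply: near_eq_is_derive dg.
    near=> s; rewrite /bump ifT//.
    by near: s; exact: lt_nbhsr.
- have -> : bump m.+2 t - m%:R * bump m.+1 t = 0.
    by rewrite /bump ltNge (ltW t0)/= mulr0 subr0.
  apply: (@near_eq_is_derive _ _ _ (cst 0)).
    near=> s; rewrite /bump ifF//; apply/negbTE; rewrite -leNgt ltW//.
    by near: s; exact: lt_nbhsl.
- rewrite /bump ltxx mulr0 subr0.
  suff H : (fun h => h^-1 *: ((bump m \o shift (0 : R)) (h *: 1) -
      bump m (0 : R))) @ 0^' --> (0 : R).
    apply: DeriveDef; [by apply/cvg_ex; exists 0|exact: cvg_lim].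
  apply/cvgrPdist_lt => e e0.
  have f0 : 0 < m.+2`!%:R :> R by rewrite ltr0n fact_gt0.
  near=> h.
  rewrite sub0r normrN /= addr0 [h%:A]mulr1 /bump ltxx subr0.
  case: ifPn => h0; last by rewrite scaler0 normr0.
  have := bump_le m.+1 h0; rewrite /bump h0 exprS -mulrA => hm.
  rewrite ger0_norm; last by rewrite !mulr_ge0 ?expR_ge0 ?exprn_ge0// invr_ge0
    ltW.
  rewrite (le_lt_trans hm)// -ltr_pdivlMl// mulrC.
  rewrite (le_lt_trans (ler_norm _))//.
  near: h; apply: dnbhs0_lt; rewrite divr_gt0//.
Unshelve. all: by end_near. Qed.

End Bump.

(** * Smooth functions of the tail energies *)

Section Smooth.
Context {R : realType} {L : nat}.
Implicit Types (f g : 'rV[R]_L -> R) (x v : 'rV[R]_L).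

Lemma tail_energyD x y m :
  tail_energy (x + y) m = tail_energy x m + tail_energy y m.
Proof.
by rewrite /tail_energy -big_split; apply: eq_bigr => l _; rewrite mxE.
Qed.

Lemma tail_energyZ c x m : tail_energy (c *: x) m = c * tail_energy x m.
Proof.
by rewrite /tail_energy mulr_sumr; apply: eq_bigr => l _; rewrite mxE.
Qed.

Lemma tail_energy_delta (i : 'I_L) m :
  tail_energy (delta_mx 0 i : 'rV[R]_L) m = (m <= i)%:R.
Proof.
rewrite /tail_energy; have [mi|mi] := leqP m i.
  rewrite (bigD1 i)//= mxE !eqxx big1 ?addr0// => l /andP[_ /negbTE li].
  by rewrite mxE li.
rewrite big1// => l ml; rewrite mxE; have [li|//] := eqVneq l i.
by move: ml; rewrite li leqNgt mi.
Qed.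

Lemma continuous_tail_energy m :
  continuous (fun x : 'rV[R]_L => tail_energy x m).
Proof.
apply: continuous_big; first exact: add_continuous.
by move=> l _; exact: coord_continuous.
Qed.

(** Since [tail_energy] is linear in the configuration, the difference quotient of the composite in
    direction [v] is that of [phi] in the scalar direction [tail_energy v m]. *)
Lemma is_derive_tail (phi : R -> R) l m x v :
  is_derive (tail_energy x m) 1 phi l ->
  is_derive x v (fun y => phi (tail_energy y m)) (l * tail_energy v m).
Proof.
move=> [dphi dl]; have /derivable1_diffP df := dphi.
have : is_derive (tail_energy x m) (tail_energy v m) phi (l * tail_energy v m).
  apply: DeriveDef; first exact: diff_derivable.
  rewrite deriveE// -[X in 'd _ _ X]mulr1 linearZ/= -deriveE// dl
    /GRing.scale/=.
  by rewrite mulrC.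
have E : (fun h : R => h^-1 *: (((fun y => phi (tail_energy y m)) \o shift x)
  (h *: v) -
    phi (tail_energy x m))) =
  (fun h : R => h^-1 *: ((phi \o shift (tail_energy x m)) (h *: tail_energy v
    m) -
    phi (tail_energy x m))).
  by apply/funext => h; rewrite /= tail_energyD tail_energyZ.
by move=> [d1 d2]; apply: DeriveDef; [rewrite /derivable E|rewrite /derive E].
Qed.

(** A class stable under directional derivatives and large enough to contain the truncated duality
    functions. Smoothness, which concerns iterated partial derivatives of all orders, then follows
    by induction on the list of variables. *)
Inductive bump_algebra : ('rV[R]_L -> R) -> Prop :=
| bump_algebra_cst c : bump_algebra (fun=> c)
| bump_algebra_expR c m : bump_algebra (fun x => expR (c * tail_energy x m))
| bump_algebra_bump M m : bump_algebra (fun x => bump m (M - tail_energy x 0))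
| bump_algebraD f g : bump_algebra f -> bump_algebra g ->
    bump_algebra (fun x => f x + g x)
| bump_algebraM f g : bump_algebra f -> bump_algebra g ->
    bump_algebra (fun x => f x * g x).

Lemma bump_algebra_continuous f : bump_algebra f -> continuous f.
Proof.
elim=> {f} [c|c m|M m|f g _ cf _ cg|f g _ cf _ cg] x.
- exact: cst_continuous.
- apply: (@continuous_comp _ _ _ (fun x => c * tail_energy x m) expR).
    by apply: continuousM; [exact: cst_continuous|exact:
      continuous_tail_energy].
  exact: continuous_expR.
- apply: (@continuous_comp _ _ _ (fun x => M - tail_energy x 0) (bump m)).
    by apply: continuousB; [exact: cst_continuous|exact:
      continuous_tail_energy].
  apply: differentiable_continuous; apply/derivable1_diffP.
  by have [] := is_derive_bump m (M - tail_energy x 0).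
- by apply: continuousD; [exact: cf|exact: cg].
- by apply: continuousM; [exact: cf|exact: cg].
Qed.

Lemma bump_algebra_is_derive v f : bump_algebra f ->
  exists2 g, bump_algebra g & forall x, is_derive x v f (g x).
Proof.
elim=> {f} [c|c m|M m|f g af [f' af' df] ag [g' ag' dg]|f g af [f' af' df] ag
  [g' ag' dg]].
- by exists (fun=> 0) => [|x]; [exact: bump_algebra_cst|exact: is_derive_cst].
- exists (fun x => (c * tail_energy v m) * expR (c * tail_energy x m)) => [|x].
    by apply: bump_algebraM; [exact: bump_algebra_cst|exact: bump_algebra_expR].
  rewrite mulrAC; apply: (@is_derive_tail (fun t => expR (c * t))).
  by apply: is_derive_eq; rewrite /GRing.scale/=; ring.
- exists (fun x => - tail_energy v 0 * (bump m.+2 (M - tail_energy x 0) + -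
  m%:R * bump m.+1 (M - tail_energy x 0))) => [|x].
    apply: bump_algebraM; first exact: bump_algebra_cst.
    apply: bump_algebraD; first exact: bump_algebra_bump.
    by apply: bump_algebraM; [exact: bump_algebra_cst|exact: bump_algebra_bump].
  rewrite mulrC mulrN -mulNr; apply: (@is_derive_tail (fun t => bump m (M -
    t))).
  have dM : is_derive (tail_energy x 0) 1 (fun t : R => M - t) (-1).
    by apply: is_derive_eq; rewrite add0r mul1r.
  apply: (is_derive_eq (is_derive1_comp (is_derive_bump m _) dM)).
  by rewrite mulrN1 mulNr.
- by exists (fun x => f' x + g' x) => [|x];
  [exact: bump_algebraD|exact: is_deriveD].
- exists (fun x => f' x * g x + f x * g' x) => [|x].
    by apply: bump_algebraD; apply: bump_algebraM.
  have := @is_deriveM _ _ f g x v _ _ (df x) (dg x).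
  by move=> /is_derive_eq; apply; rewrite /GRing.scale/=; ring.
Qed.

Lemma bump_algebra_partial i f : bump_algebra f -> bump_algebra (partial i f).
Proof.
move=> /(bump_algebra_is_derive (delta_mx 0 i))[g ag dg].
suff -> : partial i f = g by [].
by apply/funext => x; have [_] := dg x.
Qed.

Lemma bump_algebra_derivable v x f : bump_algebra f -> derivable f x v.
Proof. by move=> /(bump_algebra_is_derive v)[g _ /(_ x)[]]. Qed.

Lemma bump_algebra_smooth f : bump_algebra f -> smooth f.
Proof.
move=> af s; suff : bump_algebra (foldr partial f s).
  move=> h; split; [exact: bump_algebra_continuous|].
  by move=> i x; exact: bump_algebra_derivable.
by elim: s => //= i s; exact: bump_algebra_partial.
Qed.

Lemma bump_algebra_exp f n : bump_algebra f -> bump_algebra (fun x => f x ^+ n).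
Proof.
move=> af; elim: n => [|n IH]; first by under eq_fun do rewrite expr0;
  exact: bump_algebra_cst.
by under eq_fun do rewrite exprS; exact: bump_algebraM.
Qed.

Lemma bump_algebra_prod (I : Type) (r : seq I) (p : pred I)
    (F : I -> 'rV[R]_L -> R) :
  (forall i, bump_algebra (F i)) ->
  bump_algebra (fun x => \prod_(i <- r | p i) F i x).
Proof.
move=> aF; elim: r => [|i r IH].
  by under eq_fun do rewrite big_nil; exact: bump_algebra_cst.
under eq_fun do rewrite big_cons; case: (p i) => //.
exact: bump_algebraM.
Qed.

End Smooth.

(** * Duality of the generators *)

Section BondDifference.
Context {R : realType} {L : nat}.
Variables (i j : 'I_L).
Hypothesis ij : j = i.+1 :> nat.
Implicit Types (f g : 'rV[R]_L -> R).

(** The derivative is given as an equality of functions so that it can be rewritten under a second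
    [partial_diff]. Membership in the algebra travels with it and supplies the derivability needed
    by the product rule. *)
Definition bond_derivative f f' :=
  bump_algebra f /\ partial_diff i j f = f'.

Let partialP f l x : derivable f x (delta_mx 0 l) ->
  is_derive x (delta_mx 0 l) f (partial l f x).
Proof. by move=> ?; exact: DeriveDef. Qed.

Let bond_derivativeP f f' (fi fj : 'rV[R]_L -> R) : bump_algebra f ->
  (forall x, is_derive x (delta_mx 0 i) f (fi x)) ->
  (forall x, is_derive x (delta_mx 0 j) f (fj x)) ->
  (forall x, fi x - fj x = f' x) -> bond_derivative f f'.
Proof.
move=> af di dj E; split => //; apply/funext => x;
  rewrite -E /partial_diff /partial.
by have [_ ->] := di x; have [_ ->] := dj x.
Qed.

Let bond_derivative_is_derive f f' : bond_derivative f f' ->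
  exists fi fj : 'rV[R]_L -> R,
  [/\ (forall x, is_derive x (delta_mx 0 i) f (fi x)),
      (forall x, is_derive x (delta_mx 0 j) f (fj x)) &
      (forall x, fi x - fj x = f' x)].
Proof.
move=> [af <-]; exists (partial i f), (partial j f); split => // x;
  by apply: partialP; exact: bump_algebra_derivable.
Qed.

Lemma bond_derivative_cst c : bond_derivative (fun=> c) (fun=> 0).
Proof.
apply: (@bond_derivativeP _ _ (fun=> 0) (fun=> 0));
  first exact: bump_algebra_cst.
by move=> x; rewrite subrr.
Qed.

Lemma bond_derivativeD f f' g g' :
  bond_derivative f f' -> bond_derivative g g' ->
  bond_derivative (fun x => f x + g x) (fun x => f' x + g' x).
Proof.
move=> df dg; case: (df) (dg) => af _ [ag _].
have [fi [fj [dfi dfj Ef]]] := bond_derivative_is_derive df.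
have [gi [gj [dgi dgj Eg]]] := bond_derivative_is_derive dg.
apply: (@bond_derivativeP _ _ (fun x => fi x + gi x) (fun x => fj x + gj x)).
- exact: bump_algebraD.
- by move=> x; rewrite -Ef -Eg; ring.
Qed.

Lemma bond_derivativeM f f' g g' :
  bond_derivative f f' -> bond_derivative g g' ->
  bond_derivative (fun x => f x * g x) (fun x => f' x * g x + f x * g' x).
Proof.
move=> df dg; case: (df) (dg) => af _ [ag _].
have [fi [fj [dfi dfj Ef]]] := bond_derivative_is_derive df.
have [gi [gj [dgi dgj Eg]]] := bond_derivative_is_derive dg.
apply: (@bond_derivativeP _ _ (fun x => fi x * g x + f x * gi x)
  (fun x => fj x * g x + f x * gj x)).
- exact: bump_algebraM.
- move=> x; apply: (is_derive_eq (is_deriveM (dfi x) (dgi x))).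
  by rewrite /GRing.scale/=; ring.
- move=> x; apply: (is_derive_eq (is_deriveM (dfj x) (dgj x))).
  by rewrite /GRing.scale/=; ring.
- by move=> x; rewrite -Ef -Eg; ring.
Qed.

Lemma eq_bond_derivative f f' g' : bond_derivative f f' -> f' =1 g' ->
  bond_derivative f g'.
Proof. by move=> df /funext <-. Qed.

Lemma bond_derivativeZ c f f' : bond_derivative f f' ->
  bond_derivative (fun x => c * f x) (fun x => c * f' x).
Proof.
move=> df; apply: (eq_bond_derivative (bond_derivativeM (bond_derivative_cst c)
  df)).
by move=> x; rewrite mul0r add0r.
Qed.

Lemma bond_derivativeX f f' n : bond_derivative f f' ->
  bond_derivative (fun x => f x ^+ n) (fun x => n%:R * f x ^+ n.-1 * f' x).
Proof.
move=> df; elim: n => [|n IH].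
  under eq_fun do rewrite expr0.
  by apply: (eq_bond_derivative (bond_derivative_cst 1)) => x; rewrite !mul0r.
under eq_fun do rewrite exprS.
apply: (eq_bond_derivative (bond_derivativeM df IH)) => x /=.
by case: n {IH} => [|n]; rewrite /= ?exprS ?expr0; ring.
Qed.

Lemma bond_derivative_prod0 (I : Type) (r : seq I) (p : pred I)
    (F : I -> 'rV[R]_L -> R) :
  (forall l, p l -> bond_derivative (F l) (fun=> 0)) ->
  bond_derivative (fun x => \prod_(l <- r | p l) F l x) (fun=> 0).
Proof.
move=> F0; elim: r => [|l r IH].
  by under eq_fun do rewrite big_nil; exact: bond_derivative_cst.
under eq_fun do rewrite big_cons; case: (boolP (p l)) => [/F0 Fl|//].
by apply: (eq_bond_derivative (bond_derivativeM Fl IH)) => x;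
  rewrite mul0r mulr0 addr0.
Qed.

(** An exchange of energy across the bond leaves every tail energy unchanged except the one starting
    at [j]. Hence the total energy, and every gap other than those at [i] and [j], is a constant for
    the bond. *)
Let tail_bond m : (m <= i)%:R - (m <= j)%:R = - (m == j)%:R :> R.
Proof.
rewrite ij [in X in _ - X]leq_eqVlt ltnS; case: eqVneq => [->|_] /=.
  by rewrite ltnn sub0r.
by rewrite subrr oppr0.
Qed.

Lemma bond_derivative_expR c m :
  bond_derivative (fun x => expR (c * tail_energy x m))
    (fun x => - (m == j)%:R * c * expR (c * tail_energy x m)).
Proof.
have d (t : R) : is_derive t 1 (fun t => expR (c * t)) (c * expR (c * t)).
  by apply: is_derive_eq; rewrite /GRing.scale/=; ring.
apply: bond_derivativeP (bump_algebra_expR c m) (fun x => is_derive_tail _ (d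
  _))
  (fun x => is_derive_tail _ (d _)) _ => x.
by rewrite !tail_energy_delta -tail_bond; ring.
Qed.

Lemma bond_derivative_bump M n :
  bond_derivative (fun x => bump n (M - tail_energy x 0)) (fun=> 0).
Proof.
(* The derivative is left unevaluated: it gets multiplied by a difference of tail energies from site
   [0], which is zero. *)
have d (t : R) : is_derive t 1 (fun t => bump n (M - t)) ('D_1 (fun t => bump n
  (M - t)) t).
  apply: DeriveDef => //.
  have dM : is_derive t 1 (fun t : R => M - t) (-1).
    by apply: is_derive_eq; rewrite add0r mul1r.
  by have [] := is_derive1_comp (is_derive_bump n _) dM.
apply: bond_derivativeP (bump_algebra_bump M n) (fun x => is_derive_tail _ (d
  _))
  (fun x => is_derive_tail _ (d _)) _ => x.
by rewrite !tail_energy_delta !leq0n subrr.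
Qed.

End BondDifference.

(** * Intertwining of the ABEP and SIP bond operators *)

Section Intertwining.
Context {R : realType} {L : nat} {sigma k : R}.
Hypotheses (sigma_gt0 : 0 < sigma) (k_gt0 : 0 < k).
Implicit Types (x : 'rV[R]_L) (xi : 'rV[nat]_L) (i j : 'I_L).

Definition duality_weight (n : nat) : R := Gamma (2 * k) / Gamma (2 * k + n%:R).

(** The coordinates in which ABEP becomes the symmetric Brownian energy process; in them the duality
    function is the classical product of powers. *)
Definition energy_gap x (i : nat) : R :=
  (expR (- (2 * sigma * tail_energy x i.+1)) -
   expR (- (2 * sigma * tail_energy x i))) / (2 * sigma).

Definition duality_factor x (i n : nat) : R :=
  duality_weight n * energy_gap x i ^+ n.

Lemma tail_energyS x i : tail_energy x i = x 0 i + tail_energy x i.+1.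
Proof.
rewrite /tail_energy (bigD1 i)//=; congr (_ + _); apply: eq_bigl => l.
by rewrite andbC ltn_neqAle eq_sym.
Qed.

Lemma duality_functionE x xi :
  duality_function sigma k x xi = \prod_(i < L) duality_factor x i (xi 0 i).
Proof. by []. Qed.

(** This recurrence is all that the intertwining uses of the Gamma function. *)
Lemma duality_weightS n :
  duality_weight n = (2 * k + n%:R) * duality_weight n.+1.
Proof.
have c0 : 0 < 2 * k + n%:R by rewrite ltr_wpDr// mulr_gt0.
rewrite /duality_weight -[n.+1%:R]natr1 addrA Gamma_recurrence// invfM.
by rewrite mulrCA mulVKf ?gt_eqF.
Qed.

Lemma duality_factor_pair x xi i j (n m : nat) : i != j ->
  duality_function sigma k x
    (\row_l (if l == i then n else if l == j then m else xi 0 l)) =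
  duality_factor x i n * duality_factor x j m *
  \prod_(l < L | (l != i) && (l != j)) duality_factor x l (xi 0 l).
Proof.
move=> ij; rewrite duality_functionE (bigD1 i)//= (bigD1 j) 1?eq_sym//= mulrA.
rewrite !mxE eqxx eq_sym (negbTE ij) eqxx; congr (_ * _).
by apply: eq_bigr => l /andP[/negbTE li /negbTE lj]; rewrite mxE li lj.
Qed.

Lemma row_pairE xi i j :
  xi = \row_l (if l == i then xi 0 i else if l == j then xi 0 j else xi 0 l).
Proof.
by apply/rowP => l; rewrite mxE; case: eqVneq => [->//|_];
  case: eqVneq => [->|].
Qed.

Lemma move_leftE xi i j : i != j ->
  move xi i j =
    \row_l (if l == i then (xi 0 i).-1
            else if l == j then (xi 0 j).+1 else xi 0 l).
Proof.
move=> ij; apply/rowP => l; rewrite !mxE.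
case: (eqVneq l i) => [->|_].
  by rewrite (negbTE ij) addn0 subn1.
by case: (eqVneq l j) => [->|_]; rewrite subn0 ?addn1 ?addn0.
Qed.

Lemma move_rightE xi i j : i != j ->
  move xi j i =
    \row_l (if l == i then (xi 0 i).+1
            else if l == j then (xi 0 j).-1 else xi 0 l).
Proof.
move=> ij; apply/rowP => l; rewrite !mxE.
case: (eqVneq l i) => [->|_]; first by rewrite (negbTE ij) subn0 addn1.
by case: (eqVneq l j) => [->|_]; rewrite ?subn1 ?subn0 addn0.
Qed.

(** In the variables [energy_gap x l], a bond of ABEP becomes
    [u v (d_u - d_v)^2 - 2 k (u - v) (d_u - d_v)]; the hypotheses on [Y] encode
    the change of variables. *)
Lemma ABEP_change_of_variables (A B Y u v p1 p2 : R) : 0 < Y ->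
  Y * (1 - A) = 2 * sigma * u -> Y * (B - 1) = 2 * sigma * v ->
  1 / (4 * sigma ^+ 2) * ((1 - A) * (B - 1)) *
    (p2 * Y ^+ 2 + p1 * (2 * sigma * Y)) -
  1 / (2 * sigma) * ((1 - A) * (B - 1) + 2 * k * (2 - A - B)) * (p1 * Y) =
  u * v * p2 - 2 * k * (u - v) * p1.
Proof.
move=> Y0 hA hB; have YN0 : Y != 0 by rewrite gt_eqF.
have sN0 : sigma != 0 by rewrite gt_eqF.
have -> : A = 1 - 2 * sigma * u / Y by rewrite -hA; field.
have -> : B = 1 + 2 * sigma * v / Y by rewrite -hB; field.
by field; rewrite sN0 YN0.
Qed.

(** The recurrence expresses every weight through [w a * w b]: a factor [2 * k + n%:R] absorbs the
    step up, and the number of particles at the departure site pairs with the step down. What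
    remains is a polynomial identity in [u] and [v]. *)
Lemma SIP_bond_identity (w : nat -> R) (c r u v : R) (a b : nat) :
  (forall n, w n = (2 * k + n%:R) * w n.+1) ->
  c * r * (w a * w b) * (u * v *
     (a%:R * a.-1%:R * u ^+ a.-2 * v ^+ b
      - 2 * (a%:R * b%:R * u ^+ a.-1 * v ^+ b.-1)
      + b%:R * b.-1%:R * u ^+ a * v ^+ b.-2)
   - 2 * k * (u - v) *
     (a%:R * u ^+ a.-1 * v ^+ b + -1 * (b%:R * u ^+ a * v ^+ b.-1))) =
  a%:R * (2 * k + b%:R) *
    (c * (w a.-1 * u ^+ a.-1 * (w b.+1 * v ^+ b.+1) * r) -
     c * r * (w a * w b) * (u ^+ a * v ^+ b)) +
  b%:R * (2 * k + a%:R) *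
    (c * (w a.+1 * u ^+ a.+1 * (w b.-1 * v ^+ b.-1) * r) -
     c * r * (w a * w b) * (u ^+ a * v ^+ b)).
Proof.
move=> wS.
(* The factor [n%:R] makes the downward step valid also at [n = 0], where [n.-1] is truncated. *)
have E (n : nat) : n%:R * w n.-1 = n%:R * (2 * k + n%:R - 1) * w n.
  by case: n => [|n]; rewrite ?mul0r// wS -[n.+1%:R]natr1 addrA addrK mulrA.
have Eu : a%:R * w a.-1 = a%:R * (2 * k + a%:R - 1) * w a by [].
have Ev : b%:R * w b.-1 = b%:R * (2 * k + b%:R - 1) * w b by [].
transitivity (c * r * (
  (a%:R * w a.-1) * u ^+ a.-1 * (((2 * k + b%:R) * w b.+1) * v ^+ b.+1)
  - a%:R * (2 * k + b%:R) * (w a * u ^+ a * (w b * v ^+ b))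
  + (((2 * k + a%:R) * w a.+1) * u ^+ a.+1 * ((b%:R * w b.-1) * v ^+ b.-1))
  - b%:R * (2 * k + a%:R) * (w a * u ^+ a * (w b * v ^+ b)))); last by ring.
rewrite -!wS Eu Ev; move: (w a) (w b) => wa wb.
(* The cases 0, 1 and at least 2 resolve the truncated exponents [.-1] and [.-2]. *)
by case: a {Eu} => [|[|a]]; case: b {Ev} => [|[|b]]; rewrite /= ?exprS ?expr0;
  ring.
Qed.

Definition truncated_duality (M : R) x xi : R :=
  bump 0 (M - tail_energy x 0) * duality_function sigma k x xi.

Lemma energy_gap_bump_algebra (l : nat) :
  bump_algebra (fun x : 'rV[R]_L => energy_gap x l).
Proof.
have -> : (fun x : 'rV[R]_L => energy_gap x l) = (fun x =>
  (expR (- (2 * sigma) * tail_energy x l.+1) +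
   -1 * expR (- (2 * sigma) * tail_energy x l)) * (2 * sigma)^-1).
  by apply/funext => x; rewrite /energy_gap !mulNr mul1r.
apply: bump_algebraM; last exact: bump_algebra_cst.
apply: bump_algebraD; first exact: bump_algebra_expR.
by apply: bump_algebraM; [exact: bump_algebra_cst|exact: bump_algebra_expR].
Qed.

Lemma truncated_duality_bump_algebra M xi :
  bump_algebra (fun x => truncated_duality M x xi).
Proof.
apply: bump_algebraM; first exact: bump_algebra_bump.
apply: bump_algebra_prod => i; apply: bump_algebraM;
  first exact: bump_algebra_cst.
exact: (bump_algebra_exp _ (energy_gap_bump_algebra _)).
Qed.

Section Bond.
Variables (i j : 'I_L).
Hypothesis ij : j = i.+1 :> nat.

Let y x := expR (- (2 * sigma) * tail_energy x j).

Let dy : bond_derivative i j y (fun x => 2 * sigma * y x).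
Proof.
apply: (eq_bond_derivative (bond_derivative_expR ij _ _)) => x.
by rewrite eqxx /y mulN1r opprK.
Qed.

(** The tail energy from [j] enters the gaps at [i] and [j] with opposite signs. With [u] and [v]
    for these gaps, the bond derivative therefore acts on functions of them as [y] times d_u - d_v;
    since [y] has bond derivative [2 * sigma * y], a second application also produces a first-order
    term. *)
Lemma bond_derivative_energy_gap (l : nat) :
  bond_derivative i j (fun x => energy_gap x l)
    (fun x => ((l == i)%:R - (l == j)%:R) * y x).
Proof.
have -> : (fun x : 'rV[R]_L => energy_gap x l) = (fun x =>
  (2 * sigma)^-1 * (expR (- (2 * sigma) * tail_energy x l.+1) +
   -1 * expR (- (2 * sigma) * tail_energy x l))).
  by apply/funext => x; rewrite /energy_gap !mulNr mul1r mulrC.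
apply: (eq_bond_derivative (bond_derivativeZ _ (bond_derivativeD
  (bond_derivative_expR ij _ _) (bond_derivativeZ _ (bond_derivative_expR ij _
    _))))).
have sN0 : sigma != 0 by rewrite gt_eqF.
have -> : (l.+1 == j) = (l == i) by rewrite ij eqSS.
move=> x /=; rewrite /y; have [->|li] := eqVneq l i.
  rewrite -[X in tail_energy x X]ij ltn_eqF ?ij//=.
  by field.
have [->|lj] := eqVneq l j => /=; by field.
Qed.

Lemma truncated_duality_bond M xi x :
  ABEP_bond sigma k i j (fun x => truncated_duality M x xi) x =
  SIP_bond k i j (fun eta => truncated_duality M x eta) xi.
Proof.
have iNj : i != j by rewrite -val_eqE/= ij neq_ltn ltnSn.
set a := xi 0 i; set b := xi 0 j.
(* [W] gathers what the bond derivative treats as constant: the cut-off, the factors of the other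
   sites and the weights. *)
pose W x := bump 0 (M - tail_energy x 0) *
  \prod_(l < L | (l != i) && (l != j)) duality_factor x l (xi 0 l) *
  (duality_weight a * duality_weight b).
have dW : bond_derivative i j W (fun=> 0).
  have d0 l c : (l != i) && (l != j) -> bond_derivative i j
      (fun x => duality_factor x l c) (fun=> 0).
    move=> /andP[li lj]; apply: (eq_bond_derivative (bond_derivativeZ _
      (bond_derivativeX c (bond_derivative_energy_gap l)))) => z.
    by rewrite (negbTE li : (l == i :> nat) = false) (negbTE lj : (l == j :>
      nat) = false) subrr mul0r !mulr0.
  have d1 : bond_derivative i j (fun x => \prod_(l < L | (l != i) && (l != j))
      duality_factor x l (xi 0 l)) (fun=> 0).
    by apply: bond_derivative_prod0 => l ll; exact: d0.
  apply: (eq_bond_derivative (bond_derivativeM (bond_derivativeM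
    (bond_derivative_bump i j M 0) d1) (bond_derivative_cst i j (duality_weight
      a * duality_weight b)))) => z.
  by rewrite !(mul0r, mulr0, addr0).
pose u x := energy_gap x i; pose v x := energy_gap x j.
have du : bond_derivative i j u y.
  apply: (eq_bond_derivative (bond_derivative_energy_gap i)) => z.
  by rewrite eqxx ltn_eqF ?ij// subr0 mul1r.
have dv : bond_derivative i j v (fun x => - y x).
  apply: (eq_bond_derivative (bond_derivative_energy_gap j)) => z.
  by rewrite eqxx gtn_eqF ?ij// sub0r mulN1r.
have fE : (fun x => truncated_duality M x xi) = (fun x => W x * (u x ^+ a * v x
  ^+ b)).
  apply/funext => z; rewrite /truncated_duality {1}[xi](row_pairE xi i j).
  rewrite duality_factor_pair// /W /duality_factor -/a -/b -/(u z) -/(v z).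
  move: (duality_weight _) (duality_weight _) (u z ^+ _) (v z ^+ _) (bump _ _).
  by move: (\prod_(_ < _ | _) _) => *; ring.
(* [p1] and [p2] are d_u - d_v and its square applied to [u ^+ a * v ^+ b]. *)
pose p1 x := a%:R * u x ^+ a.-1 * v x ^+ b + -1 * (b%:R * u x ^+ a * v x ^+
  b.-1).
pose p2 x := a%:R * a.-1%:R * u x ^+ a.-2 * v x ^+ b
      - 2 * (a%:R * b%:R * u x ^+ a.-1 * v x ^+ b.-1)
      + b%:R * b.-1%:R * u x ^+ a * v x ^+ b.-2.
have d1 : bond_derivative i j (fun x => truncated_duality M x xi)
    (fun x => W x * (p1 x * y x)).
  rewrite fE; apply: (eq_bond_derivative (bond_derivativeM dW
    (bond_derivativeM (bond_derivativeX a du) (bond_derivativeX b dv)))) => z.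
  by rewrite /p1; move: (W z) (u z) (v z) (y z) (a) (b) => *; ring.
have d2 : bond_derivative i j (fun x => W x * (p1 x * y x))
    (fun x => W x * (p2 x * y x ^+ 2 + p1 x * (2 * sigma * y x))).
  apply: (eq_bond_derivative (bond_derivativeM dW (bond_derivativeM
    (bond_derivativeD
      (bond_derivativeM (bond_derivativeZ a%:R (bond_derivativeX a.-1 du))
        (bond_derivativeX b dv))
      (bond_derivativeZ (-1) (bond_derivativeM (bond_derivativeZ b%:R
        (bond_derivativeX a du)) (bond_derivativeX b.-1 dv)))) dy))) => z.
  by rewrite /p1 /p2; move: (W z) (u z) (v z) (y z) (a) (b) => *; ring.
have sN0 : 2 * sigma != 0 by rewrite gt_eqF// mulr_gt0.
(* Multiplying by [y] shifts the local exponentials of the rates to tail exponentials, whose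
   differences are the two gaps. *)
have hA : y x * (1 - expR (- (2 * sigma * x 0 i))) = 2 * sigma * u x.
  rewrite /u /energy_gap mulrC [RHS]mulrC divfK// tail_energyS -ij /y mulrBl
    mul1r.
  by rewrite -expRD; congr (expR _ - expR _); ring.
have hB : y x * (expR (2 * sigma * x 0 j) - 1) = 2 * sigma * v x.
  rewrite /v /energy_gap [RHS]mulrC divfK// /y mulrBr mulr1 mulNr -expRD.
  by rewrite (tail_energyS x j); congr (expR _ - expR _); ring.
rewrite /ABEP_bond; case: d1 => a1 ->; case: d2 => _ ->.
rewrite [1 / (4 * _) * _ * _]mulrCA [1 / (2 * _) * _ * _]mulrCA -mulrBr.
rewrite (ABEP_change_of_variables (p1 x) (p2 x) (expR_gt0 _) hA hB).
rewrite /SIP_bond -/a -/b move_leftE// move_rightE// -/a -/b.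
have /= -> := congr1 (fun h => h x) fE.
rewrite /truncated_duality !duality_factor_pair//.
rewrite /W /duality_factor -/(u x) -/(v x).
exact: SIP_bond_identity duality_weightS.
Qed.

End Bond.

Lemma truncated_duality_intertwining M xi x :
  ABEP_operator sigma k (fun x => truncated_duality M x xi) x =
  SIP_operator k (fun eta => truncated_duality M x eta) xi.
Proof.
by apply: eq_bigr => i _; apply: eq_bigr => j /eqP ij;
  exact: truncated_duality_bond.
Qed.

End Intertwining.

(** * Markov semigroups *)

Section BoundedExpectation.
Context {R : realType} {d : measure_display} {Omega : measurableType d}.
Variable P : probability Omega R.
Implicit Types f g : Omega -> R.

Definition bounded_rv f :=
  measurable_fun setT f /\ exists C, forall w, `|f w| <= C.

(** On bounded variables the expectation is finite and [fine] loses nothing, so [mean] inherits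
    linearity and monotonicity. *)
Definition mean f : R := fine 'E_P[f]%E.

Lemma bounded_rv_integrable f : bounded_rv f -> P.-integrable setT (EFin \o f).
Proof.
move=> [mf [C fC]]; apply: measurable_bounded_integrable => //.
  by apply: (@le_lt_trans _ _ 1%E); rewrite ?ltry//; exact: probability_le1.
exists C; split; first exact: num_real.
by move=> D CD w _; exact: le_trans (fC w) (ltW CD).
Qed.

Lemma expectationE f : bounded_rv f -> ('E_P[f] = (mean f)%:E)%E.
Proof.
move=> bf; rewrite /mean fineK// unlock; apply: integrable_fin_num => //.
exact: bounded_rv_integrable.
Qed.

Lemma bounded_rv_cst c : bounded_rv (fun=> c).
Proof. by split; [exact: measurable_cst|exists `|c|]. Qed.

Lemma bounded_rvD f g :
  bounded_rv f -> bounded_rv g -> bounded_rv (fun w => f w + g w).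
Proof.
move=> [mf [C fC]] [mg [D gD]]; split; first exact: measurable_funD.
by exists (C + D) => w; rewrite (le_trans (ler_normD _ _))// lerD.
Qed.

Lemma bounded_rvZ c f : bounded_rv f -> bounded_rv (fun w => c * f w).
Proof.
move=> [mf [C fC]]; split; first exact: measurable_funM (measurable_cst c) mf.
by exists (`|c| * C) => w; rewrite normrM ler_wpM2l.
Qed.

Lemma meanD f g : bounded_rv f -> bounded_rv g ->
  mean (fun w => f w + g w) = mean f + mean g.
Proof.
move=> bf bg; apply: EFin_inj; rewrite EFinD -!expectationE//;
  last exact: bounded_rvD.
by rewrite unlock -integralD_EFin//; exact: bounded_rv_integrable.
Qed.

Lemma meanZ c f : bounded_rv f -> mean (fun w => c * f w) = c * mean f.
Proof.
move=> bf; apply: EFin_inj; rewrite EFinM -!expectationE//;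
  last exact: bounded_rvZ.
by rewrite unlock -integralZl//; exact: bounded_rv_integrable.
Qed.

Lemma mean_cst c : mean (fun=> c) = c.
Proof. by rewrite /mean expectation_cst. Qed.

Lemma bounded_rvB f g :
  bounded_rv f -> bounded_rv g -> bounded_rv (fun w => f w - g w).
Proof.
move=> bf bg; under eq_fun do rewrite -mulN1r.
by apply: bounded_rvD => //; exact: bounded_rvZ.
Qed.

Lemma meanB f g : bounded_rv f -> bounded_rv g ->
  mean (fun w => f w - g w) = mean f - mean g.
Proof.
move=> bf bg; under eq_fun do rewrite -mulN1r.
by rewrite meanD ?meanZ ?mulN1r//; exact: bounded_rvZ.
Qed.

Lemma mean_ge0 f : (forall w, 0 <= f w) -> 0 <= mean f.
Proof. by move=> f0; apply: fine_ge0; exact: expectation_ge0. Qed.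

Lemma ler_mean f g : bounded_rv f -> bounded_rv g -> (forall w, f w <= g w) ->
  mean f <= mean g.
Proof.
move=> bf bg fg; rewrite -subr_ge0 -meanB//.
by apply: mean_ge0 => w; rewrite subr_ge0.
Qed.

Lemma ler_norm_mean f g : bounded_rv f -> bounded_rv g ->
  (forall w, `|f w| <= g w) -> `|mean f| <= mean g.
Proof.
move=> bf bg fg; rewrite ler_norml -mulN1r -meanZ//; apply/andP; split.
  apply: ler_mean => //; first exact: bounded_rvZ.
  by move=> w; rewrite mulN1r lerNl (le_trans _ (fg w))// -normrN ler_norm.
by apply: ler_mean => // w; rewrite (le_trans _ (fg w))// ler_norm.
Qed.

Lemma bounded_rv_sum (I : Type) (r : seq I) (p : pred I) (F : I -> Omega -> R) :
  (forall i, bounded_rv (F i)) ->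
  bounded_rv (fun w => \sum_(i <- r | p i) F i w).
Proof.
move=> bF; elim: r => [|i r IH].
  by under eq_fun do rewrite big_nil; exact: bounded_rv_cst.
by under eq_fun do rewrite big_cons; case: (p i) => //; exact: bounded_rvD.
Qed.

Lemma mean_sum (I : Type) (r : seq I) (p : pred I) (F : I -> Omega -> R) :
  (forall i, bounded_rv (F i)) ->
  mean (fun w => \sum_(i <- r | p i) F i w) = \sum_(i <- r | p i) mean (F i).
Proof.
move=> bF; elim: r => [|i r IH].
  by under eq_fun do rewrite big_nil; rewrite big_nil mean_cst.
under eq_fun do rewrite big_cons; rewrite big_cons; case: (p i) => //.
by rewrite meanD ?IH//; exact: bounded_rv_sum.
Qed.

End BoundedExpectation.

(** * Chapman-Kolmogorov equation *)

Section Semigroup.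
Context {R : realType} {T : ptopologicalType}.
Context {d : measure_display} {Omega : measurableType d}.
Variables (S : set T) (X : R -> Omega -> T) (P : T -> probability Omega R).
Hypotheses (markov : markov_process S X P) (S_borel : borel_set S).
Notation G := (g_sigma_algebraType (@open T)).
Implicit Types (f : T -> R) (s t : R) (x : T).

Lemma semigroupE t f x : semigroup X P t f x = mean (P x) (fun w => f (X t w)).
Proof. by []. Qed.

Lemma measurable_state t : 0 <= t -> measurable_fun setT (X t : Omega -> G).
Proof. by move=> t0 _ B mB; rewrite setTI;
  exact: (markov_measurable markov). Qed.

(** The bounds are asked on [S] only, because the duality functions need not be bounded off the
    orthant. The sign is fixed because the kernels below integrate nonnegative functions. *)
Definition bounded_borel f :=
  measurable_fun setT (f : G -> R) /\ exists C, forall x, S x -> 0 <= f x <= C.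

Lemma bounded_borel_rv t f :
  0 <= t -> bounded_borel f -> bounded_rv (fun w => f (X t w)).
Proof.
move=> t0 [mf [C fC]]; split.
  exact: (measurableT_comp mf (measurable_state t0)).
exists C => w; have /andP[f0 fC'] := fC _ (markov_state markov w t0).
by rewrite ger0_norm.
Qed.

Lemma semigroup_bounds t f x C : 0 <= t -> bounded_borel f ->
  (forall y, S y -> 0 <= f y <= C) -> 0 <= semigroup X P t f x <= C.
Proof.
move=> t0 bf fC.
have H w : 0 <= f (X t w) <= C by exact/fC/(markov_state markov).
rewrite semigroupE mean_ge0 /=; last by move=> w; have /andP[] := H w.
rewrite -[leRHS](mean_cst (P x)); apply: ler_mean;
  [exact: bounded_borel_rv|exact: bounded_rv_cst|].
by move=> w; have /andP[] := H w.
Qed.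

Lemma semigroup0 f x : S x -> borel_set [set x] -> bounded_borel f ->
  semigroup X P 0 f x = f x.
Proof.
move=> Sx Bx bf; rewrite semigroupE -[RHS](mean_cst (P x)) /mean unlock.
congr fine; have mx := markov_measurable markov (lexx 0) Bx.
apply: ae_eq_integral => //.
- by apply/measurable_EFinP; have [] := bounded_borel_rv (lexx 0) bf.
- exists (~` (X 0 @^-1` [set x])); split; first exact: measurableC.
    apply: etrans (probability_setC (P x) mx) _.
    by rewrite (markov_start markov Sx) subee.
  by move=> w /= /not_implyP[_ fw] wx; apply: fw; rewrite wx.
Qed.

Section Chapman_Kolmogorov.
Variables (s t : R) (f : T -> R).
Hypotheses (s_ge0 : 0 <= s) (t_ge0 : 0 <= t) (bf : bounded_borel f).

Let kernel (w : Omega) : giry G R :=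
  giry_map (measurable_state t_ge0) (P (X s w)).

Let measurable_kernel : measurable_fun setT kernel.
Proof.
apply: measurable_giry_codensity => // B mB.
apply: (@measurable_comp _ _ _ _ _ _ (S : set G)
  (fun x => P x (X t @^-1` B) : \bar R) _ (X s : Omega -> G)).
- exact: S_borel.
- by move=> _ [w _ <-]; exact: (markov_state markov).
- exact: (markov_kernel markov).
- exact: measurable_state.
Qed.

(** The absolute value is nonnegative everywhere, as integration against a kernel requires, and it
    agrees with [f] on [S], where the process lives. *)
Let h (x : G) : \bar R := `|f x|%:E.

Let mh : measurable_fun setT h.
Proof. by apply/measurable_EFinP; apply: measurableT_comp => //;
  have [] := bf. Qed.

Let h_ge0 x : (0 <= h x)%E. Proof. by rewrite lee_fin. Qed.

Let semigroup_kernel w : (semigroup X P t f (X s w))%:E = giry_int (kernel w) h.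
Proof.
rewrite semigroupE -expectationE; last exact: bounded_borel_rv.
rewrite giry_int_map// /giry_int unlock; apply: eq_integral => w' _.
have [_ [C fC]] := bf; have /andP[f0 _] := fC _ (markov_state markov w' t_ge0).
by rewrite /h /= ger0_norm.
Qed.

Lemma semigroup_rv : bounded_rv (fun w => semigroup X P t f (X s w)).
Proof.
split.
  apply/measurable_EFinP; rewrite (_ : _ \o _ = (giry_int ^~ h) \o kernel).
    by apply: measurableT_comp => //; exact: measurable_giry_int.
  by apply/funext => w /=; rewrite semigroup_kernel.
have [_ [C fC]] := bf; exists C => w.
by have /andP[f0 fC'] := semigroup_bounds (X s w) t_ge0 bf fC;
  rewrite ger0_norm.
Qed.

(** The Markov property with the trivial past event says that the law of [X (s + t)] is the bind of
    [P x] with [kernel]; the claim is the integral of [h] against these two equal measures. *)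
Lemma semigroupD x : S x ->
  semigroup X P (s + t) f x = semigroup X P s (semigroup X P t f) x.
Proof.
move=> Sx; have st_ge0 : 0 <= s + t by rewrite addr_ge0.
rewrite !semigroupE; apply: EFin_inj.
rewrite -!expectationE; [|exact: semigroup_rv|exact: bounded_borel_rv].
rewrite unlock; under [RHS]eq_integral do rewrite semigroup_kernel.
rewrite -[RHS](giry_int_bind (P x) measurable_kernel mh h_ge0).
transitivity (giry_int (giry_map (measurable_state st_ge0) (P x)) h).
  rewrite giry_int_map// /giry_int; apply: eq_integral => w _.
  have [_ [C fC]] := bf; have /andP[f0 _] := fC _ (markov_state markov w
    st_ge0).
  by rewrite /h /= ger0_norm.
apply: eq_measure_integral => B mB _.
have pastT : past X s setT.
  apply: sub_sigma_algebra; exists 0, setT; split; rewrite ?lexx//.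
  by apply: sub_sigma_algebra; exact: openT.
have := markov_property markov Sx s_ge0 t_ge0 pastT mB.
rewrite setTI => H; apply: (etrans H); apply/esym.
exact: (giry_int_map measurable_kernel (P x) (measurable_giry_ev mB)).
Qed.

End Chapman_Kolmogorov.

End Semigroup.

(** * Duality of the semigroups *)

Section ParticleNumber.
Context {R : realType} {L : nat}.
Implicit Types (xi : 'rV[nat]_L) (f g : 'rV[nat]_L -> R) (i j : 'I_L).

Definition particles xi : nat := (\sum_i xi 0%R i)%N.

Lemma particles_move xi i j : i != j -> (0 < xi 0%R i)%N ->
  particles (move xi i j) = particles xi.
Proof.
move=> ij xi0; rewrite /particles (bigD1 i)//= (bigD1 j) 1?eq_sym//=.
rewrite [RHS](bigD1 i)//= [in RHS](bigD1 j) 1?eq_sym//= !addnA.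
rewrite !mxE !eqxx (negbTE ij) eq_sym (negbTE ij) subn0 addn0 addn1 addnS
  -addSn subn1 prednK//.
congr (_ + _)%N; apply: eq_bigr => l /andP[/negbTE li /negbTE lj].
by rewrite mxE li lj subn0 addn0.
Qed.

Lemma le_particles xi i : (xi 0%R i <= particles xi)%N.
Proof. by rewrite /particles (bigD1 i)//= leq_addr. Qed.

Lemma SIP_operatorB k f g xi : SIP_operator k (fun eta => f eta - g eta) xi =
  SIP_operator k f xi - SIP_operator k g xi.
Proof.
rewrite /SIP_operator -sumrB; apply: eq_bigr => i _; rewrite -sumrB.
by apply: eq_bigr => j _; rewrite /SIP_bond; ring.
Qed.

Lemma SIP_operatorZ k c f xi : SIP_operator k (fun eta => c * f eta) xi =
  c * SIP_operator k f xi.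
Proof.
rewrite /SIP_operator mulr_sumr; apply: eq_bigr => i _; rewrite mulr_sumr.
by apply: eq_bigr => j _; rewrite /SIP_bond; ring.
Qed.

Lemma SIP_operator_cst k c xi : SIP_operator k (fun=> c) xi = 0 :> R.
Proof.
by rewrite /SIP_operator big1// => i _; rewrite big1// => j _;
  rewrite /SIP_bond; ring.
Qed.

(** A move out of an empty site would create a particle, because of the truncated subtraction, and
    lead to a configuration where [f] is not controlled; its rate is zero. Each of the other moves
    contributes at most its rate times [2 * b]. *)
Lemma norm_SIP_bond_le k f xi i j (b : R) : 0 <= k -> j = i.+1 :> nat ->
  (forall eta, particles eta = particles xi -> `|f eta| <= b) ->
  `|SIP_bond k i j f xi| <=
    4 * ((particles xi)%:R * (2 * k + (particles xi)%:R)) * b.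
Proof.
move=> k0 ij fb; have iNj : i != j by rewrite -val_eqE/= ij neq_ltn ltnSn.
set n := particles xi.
have term a c : a != c -> `|(xi 0 a)%:R * (2 * k + (xi 0 c)%:R) * (f (move xi a
  c) - f xi)|
   <= n%:R * (2 * k + n%:R) * (2 * b).
  move=> ac; have [a0|a0] := posnP (xi 0 a).
    rewrite a0 !mul0r normr0 !mulr_ge0 ?addr_ge0 ?mulr_ge0//.
    by rewrite (le_trans _ (fb xi erefl)).
  rewrite normrM ler_pM//.
    rewrite ger0_norm; last by rewrite !mulr_ge0// addr_ge0// mulr_ge0.
    by rewrite ler_pM ?addr_ge0 ?mulr_ge0// ?lerD2l ler_nat le_particles.
  rewrite (le_trans (ler_normB _ _))// mulr_natl mulr2n lerD// fb//.
  exact: particles_move.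
rewrite /SIP_bond (le_trans (ler_normD _ _))//.
apply: le_trans (lerD (term _ _ iNj) (term j i _)) _; first by rewrite eq_sym.
by rewrite le_eqVlt; apply/orP; left; apply/eqP; ring.
Qed.

Lemma norm_SIP_operator_le k (n : nat) : 0 <= k ->
  exists2 C : R, 0 < C & forall f b xi, particles xi = n ->
    (forall eta, particles eta = n -> `|f eta| <= b) ->
    `|SIP_operator k f xi| <= C * b.
Proof.
move=> k0; pose c : R := 4 * (n%:R * (2 * k + n%:R)).
have c0 : 0 <= c by rewrite !mulr_ge0// addr_ge0// mulr_ge0.
exists (1 + \sum_(i < L) \sum_(j < L | j == i.+1 :> nat) c).
  by rewrite ltr_pwDl// sumr_ge0// => i _; rewrite sumr_ge0.
move=> f b xi xin fb; have b0 : 0 <= b by rewrite (le_trans _ (fb xi xin)).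
rewrite mulrDl mul1r mulr_suml (le_trans (ler_norm_sum _ _ _))//.
rewrite (@le_trans _ _ (\sum_(i < L) (\sum_(j < L | j == i.+1 :> nat) c) *
  b))//;
  last by rewrite lerDr.
apply: ler_sum => i _; rewrite mulr_suml (le_trans (ler_norm_sum _ _ _))//.
apply: ler_sum => j /eqP ij; rewrite /c -xin; apply: norm_SIP_bond_le => //.
by move=> eta; rewrite xin; exact: fb.
Qed.

Lemma SIP_equation_unique (k B : R) (n : nat) (z : 'rV[nat]_L -> R -> R) :
  0 <= k -> 0 <= B ->
  (forall xi t, particles xi = n -> 0 <= t ->
    right_derivative (z xi) t (SIP_operator k (z^~ t) xi)) ->
  (forall xi t, particles xi = n -> 0 < t -> left_continuous (z xi) t) ->
  (forall xi, particles xi = n -> z xi 0 = 0) ->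
  (forall xi t, particles xi = n -> 0 <= t -> `|z xi t| <= B) ->
  forall xi t, particles xi = n -> 0 <= t -> z xi t = 0.
Proof.
move=> k0 B0 dz cz z0 zB.
have [C C0 HC] := norm_SIP_operator_le n k0.
apply: (@bounded_linear_ode_unique R _ [set xi | particles xi = n] z
  (fun xi t => SIP_operator k (z^~ t) xi) B C) => //.
by move=> t b t0 zb xi xin; exact: HC.
Qed.

Lemma borel_config (A : set 'rV[nat]_L) : borel_set A.
Proof.
apply: sub_sigma_algebra; rewrite openE => xi Axi.
exists (fun a c => [set xi a c]) => [a c|eta H]; first exact: discrete_set1.
suff -> : eta = xi by [].
by apply/matrixP => a c; exact: H.
Qed.

End ParticleNumber.

(** * Bounds on the duality function *)

Section DualityBound.
Context {R : realType} {L : nat} {sigma k : R}.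
Hypotheses (sigma_gt0 : 0 < sigma).
Implicit Types (x : 'rV[R]_L) (xi : 'rV[nat]_L).

Lemma tail_energy_ge0 x m : orthant x -> 0 <= tail_energy x m.
Proof. by move=> x0; exact: sumr_ge0. Qed.

Lemma le_tail_energy x (l : 'I_L) : orthant x -> x 0 l <= tail_energy x 0.
Proof.
by move=> x0; rewrite /tail_energy (bigD1 l)//= lerDl sumr_ge0.
Qed.

Lemma energy_gap_bounds x (l : 'I_L) : orthant x ->
  0 <= energy_gap (sigma := sigma) x l <= (2 * sigma)^-1.
Proof.
move=> x0; have s0 : 0 < 2 * sigma by rewrite mulr_gt0.
rewrite /energy_gap divr_ge0 ?(ltW s0)//=.
  rewrite -[leRHS]mul1r ler_pM2r ?invr_gt0//.
  rewrite (@le_trans _ _ (expR (- (2 * sigma * tail_energy x l.+1))))//.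
    by rewrite gerBl expR_ge0.
  by rewrite expR_le1 oppr_le0 mulr_ge0 ?(ltW s0)// tail_energy_ge0.
rewrite subr_ge0 ler_expR lerN2 ler_pM2l// [leRHS]tail_energyS.
by rewrite lerDr.
Qed.

Lemma Gamma_ge0 (z : R) : 0 <= Gamma z.
Proof. by apply: Rintegral_ge0 => t _; rewrite mulr_ge0 ?powR_ge0 ?expR_ge0.
  Qed.

Lemma duality_function_bounds (n : nat) : exists2 B : R, 0 <= B &
  forall x xi, orthant x -> particles xi = n ->
    0 <= duality_function sigma k x xi <= B.
Proof.
pose c m : R := duality_weight (k := k) m * (2 * sigma)^-1 ^+ m.
have w0 m : 0 <= duality_weight (k := k) m by rewrite divr_ge0 ?Gamma_ge0.
have s0 : 0 <= (2 * sigma)^-1 by rewrite invr_ge0 mulr_ge0// ltW.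
have c0 m : 0 <= c m by rewrite mulr_ge0// exprn_ge0.
(* No site holds more than [n] particles, so this sum of nonnegative terms dominates the factor of
   every site. *)
pose K := \sum_(m < n.+1) c m.
have K0 : 0 <= K by rewrite sumr_ge0.
exists (K ^+ L); first exact: exprn_ge0.
move=> x xi x0 xin; rewrite duality_functionE.
have f0 (l : 'I_L) : 0 <= duality_factor (sigma := sigma) (k := k) x l (xi 0 l)
  <= K.
  have /andP[g0 g1] := energy_gap_bounds l x0.
  rewrite mulr_ge0 ?exprn_ge0//=.
  have lin : (xi 0%R l < n.+1)%N by rewrite ltnS -xin le_particles.
  apply: (@le_trans _ _ (c (xi 0 l))).
    by rewrite ler_wpM2l// lerXn2r.
  by rewrite /K (bigD1 (Ordinal lin))//= lerDl sumr_ge0.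
rewrite prodr_ge0 /=; last by move=> l _; have /andP[] := f0 l.
rewrite -[X in K ^+ X](card_ord L) -prodr_const.
by apply: ler_prod.
Qed.

End DualityBound.

Section BorelOrthant.
Context {R : realType} {L : nat}.

Lemma borel_closed (T : ptopologicalType) (A : set T) : closed A -> borel_set A.
Proof.
move=> cA; rewrite -[A]setCK.
apply: (@measurableC _ (g_sigma_algebraType (@open T))).
by apply: sub_sigma_algebra; exact: closed_openC.
Qed.

Lemma borel_orthant : borel_set (@orthant R L).
Proof.
apply: borel_closed.
rewrite (_ : orthant = \bigcap_(l in [set: 'I_L]) [set x | 0 <= x 0 l]);
  last first.
  by apply/seteqP; split => [x H l _|x H l]; exact: H.
apply: closed_bigI => l _.
apply: (@preimage_closed _ _ (fun x : 'rV[R]_L => x 0 l) [set y | 0 <= y]).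
  by move=> x _; exact: coord_continuous.
exact: closed_ge.
Qed.

Lemma borel_set1 (x : 'rV[R]_L) : borel_set [set x].
Proof.
apply: borel_closed; apply: accessible_closed_set1.
by apply: hausdorff_accessible; exact: norm_hausdorff.
Qed.

Lemma continuous_borel (T : ptopologicalType) (f : T -> R) : continuous f ->
  measurable_fun setT (f : g_sigma_algebraType (@open T) -> R).
Proof.
move=> /continuousP cf; apply: (measurability _ (RGenOpens.measurableE R)).
move=> _ [_ [a [b ->] <-]]; rewrite setTI.
by apply: sub_sigma_algebra; apply: cf; exact: interval_open.
Qed.

End BorelOrthant.

(** * Evolution equation and particle conservation for SIP *)

Section SIPSemigroup.
Context {R : realType} {L : nat} {k : R}.
Context {d : measure_display} {Omega : measurableType d}.
Variables (Y : R -> Omega -> 'rV[nat]_L).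
Variables (Q : 'rV[nat]_L -> probability Omega R).
Hypothesis Y_SIP : is_SIP k Y Q.
Implicit Types (xi eta : 'rV[nat]_L).

Let markovY : markov_process setT Y Q. Proof. by case: Y_SIP. Qed.

Let borelT : borel_set [set: 'rV[nat]_L]. Proof. exact: borel_config. Qed.

Notation semigroup := (semigroup Y Q).

Lemma bounded_borel_config (F : 'rV[nat]_L -> R) C :
  (forall eta, 0 <= F eta <= C) -> bounded_borel setT F.
Proof.
by move=> FC; split; [move=> _ B _; exact: borel_config|exists C => eta _;
  exact: FC].
Qed.

Section BoundedFunction.
Variables (F : 'rV[nat]_L -> R) (C : R).
Hypothesis FC : forall eta, 0 <= F eta <= C.

Let bF : bounded_borel setT F. Proof. exact: bounded_borel_config FC. Qed.

Lemma SIP_semigroup_bounds t xi : 0 <= t -> 0 <= semigroup t F xi <= C.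
Proof. by move=> t0; apply: (semigroup_bounds markovY) => //. Qed.

Lemma SIP_semigroup0 xi : semigroup 0 F xi = F xi.
Proof. by apply: (semigroup0 markovY) => //; exact: borel_config. Qed.

Lemma SIP_semigroupD s t xi : 0 <= s -> 0 <= t ->
  semigroup (s + t) F xi = semigroup s (semigroup t F) xi.
Proof. by move=> s0 t0; apply: (semigroupD markovY). Qed.

(** The backward equation: with the time split as [h + t], the increment is a difference quotient at
    time zero of [semigroup t F], a bounded function, to which the definition of SIP applies. *)
Lemma SIP_right_derivative xi t : 0 <= t ->
  right_derivative (fun t => semigroup t F xi) t
    (SIP_operator k (semigroup t F) xi).
Proof.
move=> t0; have [_ _ gen] := Y_SIP.
have bG : exists M : R, forall eta, `|semigroup t F eta| <= M.
  by exists C => eta; have /andP[h0 hC] := SIP_semigroup_bounds eta t0;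
    rewrite ger0_norm.
apply: (cvg_trans _ (gen _ bG xi)); apply: near_eq_cvg; near=> h.
rewrite /difference_quotient [t + h]addrC SIP_semigroupD//.
Unshelve. all: by end_near. Qed.

End BoundedFunction.

Let hold xi eta : R := (eta == xi)%:R.

Let hold01 xi eta : 0 <= hold xi eta <= 1.
Proof. by rewrite /hold; case: eqP; rewrite lexx ler01. Qed.

(** The difference quotient of the indicator of [xi] has a finite limit, so its numerator tends to
    zero. *)
Let cvg_hold xi : semigroup h (hold xi) xi @[h --> 0^'+] --> (1 : R).
Proof.
have [_ _ gen] := Y_SIP.
have bH : exists M : R, forall eta, `|hold xi eta| <= M.
  by exists 1 => eta; have /andP[h0 h1] := hold01 xi eta; rewrite ger0_norm.
have := gen _ bH xi; set l := SIP_operator _ _ _ => dq.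
have : h * difference_quotient Y Q (hold xi) h xi + 1 @[h --> 0^'+] --> 0 * l +
  1.
  apply: cvgD; last exact: cvg_cst.
  by apply: cvgM => //; exact: cvg_at_right_filter.
rewrite mul0r add0r; apply: cvg_trans; apply: near_eq_cvg; near=> h.
by rewrite /difference_quotient mulrC divfK// /hold eqxx subrK.
Unshelve. all: by end_near. Qed.

(** For small [h], the process started from [xi] is still in [xi] at time [h]
    with probability close to [1]; hence [semigroup h G xi] is close to [G xi],
    uniformly in [G] with values in [[0, C]]. *)
Lemma SIP_left_continuous (F : 'rV[nat]_L -> R) C xi t :
  (forall eta, 0 <= F eta <= C) -> 0 < t ->
  left_continuous (fun t => semigroup t F xi) t.
Proof.
move=> FC t0; have C0 : 0 <= C by have /andP[f0] := FC xi; exact: le_trans.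
have key h : 0 < h < t ->
    `|semigroup t F xi - semigroup (t - h) F xi| <= C * (1 - semigroup h (hold
      xi) xi).
  move=> /andP[h0 ht]; have th : 0 <= t - h by rewrite subr_ge0 ltW.
  set G := semigroup (t - h) F.
  have GC eta : 0 <= G eta <= C by exact: SIP_semigroup_bounds.
  have -> : semigroup t F xi = semigroup h G xi.
    by rewrite -(SIP_semigroupD FC) ?(ltW h0)// addrC subrK.
  have rv (H : 'rV[nat]_L -> R) (D : R) : (forall eta, 0 <= H eta <= D) ->
      bounded_rv (fun w => H (Y h w)).
    by move=> HD; apply: (bounded_borel_rv markovY (ltW h0));
      exact: bounded_borel_config HD.
  rewrite !semigroupE -[X in _ - X](mean_cst (Q xi)) -[X in _ * (X -
    _)](mean_cst (Q xi)).
  rewrite -!meanB -?meanZ; do ?exact: bounded_rv_cst; do ?exact: rv GC;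
    do ?exact: rv (hold01 xi).
  - apply: ler_norm_mean.
    + by apply: bounded_rvB; [exact: rv GC|exact: bounded_rv_cst].
    + by apply: bounded_rvZ; apply: bounded_rvB;
      [exact: bounded_rv_cst|exact: rv (hold01 xi)].
    + move=> w; rewrite /hold; case: eqP => [->|_];
      first by rewrite !subrr mulr0 normr0.
      rewrite subr0 mulr1; have /andP[g0 gC] := GC (Y h w);
        have /andP[g0' gC'] := GC xi.
      by rewrite ler_norml; apply/andP; split; lra.
  - by apply: bounded_rvB; [exact: bounded_rv_cst|exact: rv (hold01 xi)].
have H : C * (1 - semigroup h (hold xi) xi) @[h --> 0^'+] --> (0 : R).
  have : C * (1 - semigroup h (hold xi) xi) @[h --> 0^'+] --> C * (1 - 1).
    by apply: cvgM; [exact: cvg_cst|apply: cvgB;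
      [exact: cvg_cst|exact: cvg_hold]].
  by rewrite subrr mulr0.
rewrite /left_continuous; apply/cvgrPdist_lt => e e0.
have He : \forall h \near 0^'+, C * (1 - semigroup h (hold xi) xi) < e.
  exact: cvgr_lt H _ e0.
near=> h.
apply: le_lt_trans (key h _) _; last first.
  by near: h; exact: He.
apply/andP; split; near: h; first exact: nbhs_right_gt.
exact: nbhs_right_lt.
Unshelve. all: by end_near. Qed.

Hypothesis k_ge0 : 0 <= k.

(** On configurations of [n] particles, the probability of having [n] particles at time [t] and the
    constant 1 solve the same equation with the same initial value. *)
Lemma SIP_particles_conserved xi t : 0 <= t ->
  semigroup t (fun eta => (particles eta == particles xi)%:R) xi = 1.
Proof.
move=> t0; set n := particles xi.
pose F eta : R := (particles eta == n)%:R.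
have F01 eta : 0 <= F eta <= 1 by rewrite /F; case: eqP; rewrite lexx ler01.
apply/eqP; rewrite -subr_eq0; apply/eqP.
apply: (@SIP_equation_unique R L k 2 n (fun eta t => semigroup t F eta - 1)) =>
  //.
- move=> eta u etan u0; rewrite SIP_operatorB.
  apply: right_derivativeB; first exact: SIP_right_derivative F01 _ _ u0.
  rewrite SIP_operator_cst; apply: is_derive_right; exact: is_derive_cst.
- move=> eta u _ u0; apply: left_continuousB; last exact: cvg_cst.
  exact: SIP_left_continuous F01 u0.
- by move=> eta etan; rewrite (SIP_semigroup0 F01) /F etan eqxx subrr.
- move=> eta u _ u0; have /andP[p0 p1] := SIP_semigroup_bounds F01 eta u0.
  by rewrite ler_norml; apply/andP; split; lra.
Qed.

End SIPSemigroup.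

(** * Evolution equation for ABEP and comparison with SIP *)

Section ABEPSemigroup.
Context {R : realType} {L : nat} {sigma k : R}.
Hypotheses (sigma_gt0 : 0 < sigma) (k_gt0 : 0 < k).
Implicit Types (x : 'rV[R]_L) (xi eta : 'rV[nat]_L).

Notation truncated := (truncated_duality (sigma := sigma) (k := k)).

(** The support matters on the orthant only, where a total energy of at most [M] confines the
    configuration to the cube with side [[0, M]]. *)
Lemma truncated_duality_test_function M xi :
  @test_function R L (fun x => truncated M x xi).
Proof.
split; first exact/bump_algebra_smooth/truncated_duality_bump_algebra.
exists [set v : 'rV[R]_L | forall i, `[0, M]%classic (v ord0 i)]; split.
- by apply: (@rV_compact _ _ (fun=> `[0, M]%classic)) => i;
  exact: segment_compact.
- by move=> v H i; have := H i; rewrite /= in_itv/= => /andP[].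
- move=> x x0 nK; have [i xi_gt] : exists i, M < x 0 i.
    apply: contrapT => H; apply: nK => i /=; rewrite in_itv/= x0/= leNgt.
    by apply/negP => ?; apply: H; exists i.
  rewrite /truncated_duality /bump ifF ?mul0r//; apply/negbTE.
  by rewrite -leNgt subr_le0 (le_trans (ltW xi_gt))// le_tail_energy.
Qed.

Lemma truncated_duality_bounds (n : nat) : exists2 B : R, 0 <= B &
  forall M x xi, orthant x -> particles xi = n ->
    0 <= truncated M x xi <= B.
Proof.
have [B B0 HB] := duality_function_bounds (L := L) (k := k) sigma_gt0 n.
exists B => // M x xi x0 xin; have /andP[D0 DB] := HB x xi x0 xin.
rewrite /truncated_duality mulr_ge0 ?bump_ge0//=.
by rewrite (le_trans _ DB)// ler_piMl// bump0_le1.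
Qed.

Lemma duality_bounded_borel xi :
  bounded_borel orthant (fun x => duality_function sigma k x xi).
Proof.
split.
  apply: continuous_borel; apply: bump_algebra_continuous.
  apply: bump_algebra_prod => i; apply: bump_algebraM;
    first exact: bump_algebra_cst.
  exact: (bump_algebra_exp _ (energy_gap_bump_algebra _)).
have [B B0 HB] := duality_function_bounds (L := L) (k := k) sigma_gt0
  (particles xi).
by exists B => x x0; exact: HB.
Qed.

Lemma truncated_duality_bounded_borel M xi :
  bounded_borel orthant (fun x : 'rV[R]_L => truncated M x xi).
Proof.
split.
  by apply: continuous_borel; apply: bump_algebra_continuous;
    exact: truncated_duality_bump_algebra.
have [B B0 HB] := truncated_duality_bounds (particles xi).
by exists B => x x0; exact: HB.
Qed.

Context {d : measure_display} {Omega : measurableType d}.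
Variables (X : R -> Omega -> 'rV[R]_L) (P : 'rV[R]_L -> probability Omega R).
Hypothesis X_ABEP : is_ABEP sigma k X P.

Let markovX : markov_process orthant X P. Proof. by case: X_ABEP. Qed.

Notation semigroup := (semigroup X P).

(** The uniformity in [y] allows the estimate to be applied at the random point [X t w] under an
    expectation. *)
Lemma ABEP_generator M xi (e : R) : 0 < e ->
  \forall h \near 0^'+, forall y, orthant y ->
    `|SIP_operator k (fun eta => truncated M y eta) xi -
      difference_quotient X P (fun x => truncated M x xi) h y| < e.
Proof.
move=> e0; have [_ _ _ [gen _]] := X_ABEP.
have [_ _ H] := gen _ (truncated_duality_test_function M xi).
have /H : nbhs (ABEP_operator sigma k (fun x => truncated M x xi) :
    {uniform` (@orthant R L) -> R}) [set h | forall y, orthant y ->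
      `|ABEP_operator sigma k (fun x => truncated M x xi) y - h y| < e].
  apply/uniform_nbhs; exists [set xy | `|xy.1 - xy.2| < e]; split => //.
  rewrite -entourage_ballE; exists e => //.
rewrite nbhs_filterE /=; apply: filterS => h Hh y y0.
by have := Hh y y0; rewrite truncated_duality_intertwining.
Qed.

Section Equation.
Variables (M : R) (n : nat) (x : 'rV[R]_L).
Hypothesis x_ge0 : orthant x.

Let f xi y := truncated M y xi.

Let mean_SIP_operator t xi : 0 <= t ->
  bounded_rv (fun w => SIP_operator k (fun eta => f eta (X t w)) xi) /\
  mean (P x) (fun w => SIP_operator k (fun eta => f eta (X t w)) xi) =
  SIP_operator k (fun eta => semigroup t (f eta) x) xi.
Proof.
move=> t0; have rv eta : bounded_rv (fun w => f eta (X t w)).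
  by apply: (bounded_borel_rv markovX t0);
    exact: truncated_duality_bounded_borel.
have rvB eta zeta (a : R) : bounded_rv (fun w => a * (f eta (X t w) - f zeta (X
  t w))).
  by apply: bounded_rvZ; exact: bounded_rvB.
have rvBond i j : bounded_rv (fun w => SIP_bond k i j (fun eta => f eta (X t
  w)) xi).
  exact: bounded_rvD.
split; first by apply: bounded_rv_sum => i; exact: bounded_rv_sum.
rewrite /SIP_operator mean_sum; last by move=> i; exact: bounded_rv_sum.
apply: eq_bigr => i _; rewrite mean_sum//; apply: eq_bigr => j _.
rewrite /SIP_bond meanD// !meanZ; try exact: bounded_rvB.
by rewrite !meanB.
Qed.

(** The forward equation: with the time split as [t + h], the increment is the mean at time [t] of
    the difference quotient of the test function. By the intertwining its limit is an SIP operator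
    in [xi], a finite sum, which commutes with the mean. *)
Lemma ABEP_right_derivative xi t : 0 <= t ->
  right_derivative (fun t => semigroup t (f xi) x) t
    (SIP_operator k (fun eta => semigroup t (f eta) x) xi).
Proof.
move=> t0; have bf := truncated_duality_bounded_borel M xi.
have [rvg <-] := mean_SIP_operator xi t0.
rewrite /right_derivative; apply/cvgrPdist_le => e e0.
have gen := ABEP_generator M xi e0.
near=> h; have h0 : 0 < h by [].
have -> : (semigroup (t + h) (f xi) x - semigroup t (f xi) x) / h =
    mean (P x) (fun w => difference_quotient X P (f xi) h (X t w)).
  rewrite /difference_quotient; under [in RHS]eq_fun do rewrite mulrC.
  rewrite meanZ; last first.
    apply: bounded_rvB; first exact: (semigroup_rv markovX borel_orthant t0
      (ltW h0)).
    exact: (bounded_borel_rv markovX t0).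
  rewrite meanB; [|exact: (semigroup_rv markovX borel_orthant t0 (ltW h0))
    |exact: (bounded_borel_rv markovX t0)].
  by rewrite (semigroupD markovX borel_orthant) ?(ltW h0)// mulrC.
have rvq : bounded_rv (fun w => difference_quotient X P (f xi) h (X t w)).
  rewrite /difference_quotient; under eq_fun do rewrite mulrC.
  apply: bounded_rvZ; apply: bounded_rvB.
    exact: (semigroup_rv markovX borel_orthant t0 (ltW h0)).
  exact: (bounded_borel_rv markovX t0).
rewrite -meanB// -[leRHS](mean_cst (P x)); apply: ler_norm_mean.
- exact: bounded_rvB.
- exact: bounded_rv_cst.
- move=> w; apply/ltW.
  have : orthant (X t w) by exact: (markov_state markovX).
  move: (X t w); near: h; exact: gen.
Unshelve. all: by end_near. Qed.

(** The increment from [t - h] to [t] is the mean of [semigroup h (f xi) - f xi] at time [t - h],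
    and this difference is of order [h] uniformly on the orthant. *)
Lemma ABEP_left_continuous xi t : 0 < t ->
  left_continuous (fun t => semigroup t (f xi) x) t.
Proof.
move=> t0; have bf := truncated_duality_bounded_borel M xi.
have [B B0 HB] := truncated_duality_bounds (particles xi).
have [C C0 HC] := @norm_SIP_operator_le R L k (particles xi) (ltW k_gt0).
have K0 : 0 < C * B + 1 by rewrite ltr_wpDl// mulr_ge0// ltW.
rewrite /left_continuous; apply/cvgrPdist_lt => e e0.
(* Tolerance 1 suffices, since only a bound on the difference quotient is needed; this is the 1 in
   [C * B + 1]. *)
have gen := ABEP_generator M xi ltr01.
near=> h; have h0 : 0 < h by [].
have ht : h < t by near: h; exact: nbhs_right_lt.
have th : 0 <= t - h by rewrite subr_ge0 ltW.
have rv1 := semigroup_rv markovX borel_orthant th (ltW h0) bf.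
have rv2 := bounded_borel_rv markovX th bf.
have -> : semigroup t (f xi) x =
    mean (P x) (fun w => semigroup h (f xi) (X (t - h) w)).
  rewrite -semigroupE -(semigroupD markovX borel_orthant) ?(ltW h0)//.
  by rewrite subrK.
rewrite semigroupE -meanB//.
apply: (@le_lt_trans _ _ (h * (C * B + 1))); last first.
  rewrite -ltr_pdivlMr//; near: h; apply: nbhs_right_lt; exact: divr_gt0.
rewrite -[leRHS](mean_cst (P x)); apply: ler_norm_mean.
- exact: bounded_rvB.
- exact: bounded_rv_cst.
move=> w; have ow : orthant (X (t - h) w) by exact: (markov_state markovX).
have : `|SIP_operator k (fun eta => truncated M (X (t - h) w) eta) xi -
      difference_quotient X P (fun x => truncated M x xi) h (X (t - h) w)| < 1.
  by move: (X (t - h) w) ow; near: h; exact: gen.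
have : `|SIP_operator k (fun eta => truncated M (X (t - h) w) eta) xi| <= C * B.
  apply: HC => // eta etan; have /andP[H0 H1] := HB M _ eta ow etan.
  by rewrite ger0_norm.
set a := SIP_operator _ _ _; rewrite /difference_quotient -/(f xi).
set b := semigroup _ _ _ - _ => aB ab.
have -> : b = h * (b / h) by rewrite mulrC divfK// gt_eqF.
rewrite normrM gtr0_norm// ler_pM2l//.
rewrite -[b / h](subKr a) (le_trans (ler_normB _ _))// lerD// ltW//.
Unshelve. all: by end_near. Qed.

Context {d' : measure_display} {Omega' : measurableType d'}.
Variables (Y : R -> Omega' -> 'rV[nat]_L).
Variables (Q : 'rV[nat]_L -> probability Omega' R).
Hypothesis Y_SIP : is_SIP k Y Q.

(** The available bound on the duality function depends on the number of particles. Restricted to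
    [n] particles the function is bounded on all configurations, so the SIP generator applies;
    conservation of particles makes the restriction invisible to the expectation. *)
Definition shell_duality eta : R :=
  (particles eta == n)%:R * duality_function sigma k x eta.

Lemma shell_duality_bounds :
  exists2 B : R, 0 <= B & forall eta, 0 <= shell_duality eta <= B.
Proof.
have [B B0 HB] := duality_function_bounds (L := L) (k := k) sigma_gt0 n.
exists B => // eta; rewrite /shell_duality.
by case: eqP => [/(HB _ _ x_ge0)|_]; rewrite ?mul1r// mul0r lexx.
Qed.

Lemma truncated_duality_semigroup xi t : particles xi = n -> 0 <= t ->
  semigroup t (f xi) x =
  bump 0 (M - tail_energy x 0) * Defs.semigroup Y Q t shell_duality xi.
Proof.
move=> xin t0; set phi := bump _ _.
have phi0 : 0 <= phi by exact: bump_ge0.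
have phi1 : phi <= 1 by exact: bump0_le1.
have [B B0 HB] := truncated_duality_bounds n.
have [B' B'0 HB'] := shell_duality_bounds.
apply/eqP; rewrite -subr_eq0; apply/eqP.
apply: (@SIP_equation_unique R L k (B + B') n
  (fun eta t => semigroup t (f eta) x - phi * Defs.semigroup Y Q t
    shell_duality eta)) => //.
- exact: ltW.
- exact: addr_ge0.
- move=> eta u etan u0; rewrite SIP_operatorB SIP_operatorZ.
  apply: right_derivativeB; first exact: ABEP_right_derivative.
  by apply: right_derivativeZ; exact: SIP_right_derivative HB' _ _ u0.
- move=> eta u etan u0; apply: left_continuousB;
  first exact: ABEP_left_continuous.
  by apply: left_continuousZ; apply: (SIP_left_continuous Y_SIP _ u0);
    exact: HB'.
- move=> eta etan; rewrite (semigroup0 markovX x_ge0 (borel_set1 _));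
  last first.
    exact: truncated_duality_bounded_borel.
  rewrite (SIP_semigroup0 Y_SIP HB') /shell_duality etan eqxx mul1r.
  by rewrite /f /truncated_duality subrr.
- move=> eta u etan u0.
  have /andP[a0 a1] := semigroup_bounds markovX x u0
    (truncated_duality_bounded_borel M eta) (fun y y0 => HB M y eta y0 etan).
  have /andP[b0 b1] := SIP_semigroup_bounds Y_SIP HB' eta u0.
  rewrite (le_trans (ler_normB _ _))// lerD ?ger0_norm// ?mulr_ge0//.
  by rewrite (le_trans _ b1)// ler_piMl.
Qed.

End Equation.
End ABEPSemigroup.

(** * Removal of the cut-off *)

Lemma bump0_ge {R : realType} (t : R) : 0 < t -> 1 - t^-1 <= bump 0 t.
Proof.
by move=> t0; rewrite /bump t0 expr0 mul1r (le_trans _ (expR_ge1Dx _)).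
Qed.

(** This settles the case [Gamma (2 * k) = 0], which the recurrence does not exclude: both
    expectations are then zero. Otherwise the vacuum has duality function 1, which makes the cut-off
    itself a truncated duality function. *)
Lemma duality_function_no_weight {R : realType} (sigma k : R) (L : nat) x xi :
  (0 < L)%N -> Gamma (2 * k) = 0 -> @duality_function R sigma k L x xi = 0.
Proof.
move=> L0 G0; rewrite /duality_function (bigD1 (Ordinal L0))//=.
by rewrite G0 !mul0r.
Qed.

Lemma duality_function_vacuum {R : realType} (sigma k : R) (L : nat) x xi :
  Gamma (2 * k) != 0 -> particles xi = 0%N ->
  @duality_function R sigma k L x xi = 1.
Proof.
move=> G0 xi0; rewrite /duality_function big1// => i _.
have := le_particles xi i; rewrite xi0 leqn0 => /eqP ->.
by rewrite addr0 divff// expr0 mul1r.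
Qed.

Theorem theorem5p2 (R : realType) (sigma k : R) (L : nat)
  (sigma_gt0 : 0 < sigma) (k_gt0 : 0 < k) (L_ge2 : (2 <= L)%N)
  (d : measure_display) (Omega : measurableType d)
  (X : R -> Omega -> 'rV[R]_L) (P : 'rV[R]_L -> probability Omega R)
  (d' : measure_display) (Omega' : measurableType d')
  (Y : R -> Omega' -> 'rV[nat]_L) (Q : 'rV[nat]_L -> probability Omega' R)
  (X_ABEP : is_ABEP sigma k X P) (Y_SIP : is_SIP k Y Q)
  (x : 'rV[R]_L) (x_ge0 : orthant x) (xi : 'rV[nat]_L)
  (t : R) (t_gt0 : 0 < t) :
  ('E_(P x)[fun w => duality_function sigma k (X t w) xi] =
   'E_(Q xi)[fun w => duality_function sigma k x (Y t w)])%E.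
Proof.
have [markovX _ _ _] := X_ABEP; have [markovY _ _] := Y_SIP.
have t_ge0 := ltW t_gt0; have k_ge0 := ltW k_gt0.
have [G0|GN0] := eqVneq (Gamma (2 * k)) 0.
  have D0 := duality_function_no_weight sigma _ _ (ltnW L_ge2) G0.
  rewrite (_ : (fun w => _) = cst 0); last by apply/funext => w; exact: D0.
  by rewrite (_ : (fun w => _) = cst 0) ?expectation_cst//; apply/funext => w;
    exact: D0.
set n := particles xi.
have [B B0 HB] := duality_function_bounds (L := L) (k := k) sigma_gt0 n.
pose D := shell_duality (sigma := sigma) (k := k) n x.
have [B' B'0 HB'] := shell_duality_bounds (k := k) sigma_gt0 n x_ge0.
have rvD : bounded_rv (fun w => D (Y t w)).
  by apply: (bounded_borel_rv markovY t_ge0); exact: bounded_borel_config HB'.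
have -> : 'E_(Q xi)[fun w => duality_function sigma k x (Y t w)]%E =
    (semigroup Y Q t D xi)%:E.
  (* On this event of probability one the duality function coincides with its restriction [D]. *)
  pose A := Y t @^-1` [set eta | particles eta = n].
  have mA : measurable A by apply: (markov_measurable markovY t_ge0);
    exact: borel_config.
  have indA w : \1_A w = (particles (Y t w) == n)%:R :> R.
    by rewrite indicE; case: eqP => h; [rewrite mem_set|rewrite memNset].
  have QA : Q xi A = 1%E.
    have := SIP_particles_conserved Y_SIP k_ge0 xi t_ge0.
    rewrite /semigroup -(funext indA) expectation_indic// => QA.
    by rewrite -[LHS]fineK ?QA//; exact: fin_num_measure.
  rewrite semigroupE -expectationE// unlock; apply: ae_eq_integral => //.
  - apply/measurable_EFinP; apply: measurableT_comp (measurable_state markovY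
    t_ge0).
    by move=> _ U _; exact: borel_config.
  - by apply/measurable_EFinP; have [] := rvD.
  - exists (~` A); split; first exact: measurableC.
      by apply: etrans (probability_setC (Q xi) mA) _; rewrite QA subee.
    move=> w /= /not_implyP[_ Dw] Aw; apply: Dw.
    by rewrite /D /shell_duality Aw eqxx mul1r.
have rvX := bounded_borel_rv markovX t_ge0 (duality_bounded_borel sigma_gt0 (k
  := k) xi).
rewrite expectationE//; congr EFin; set w0 := semigroup Y Q t D xi;
  set m := mean _ _.
pose phi M := bump 0 (M - tail_energy x 0).
(* The product [phi M * w0] is the mean of the truncated function, so the left side is the mean of
   the duality function times one minus the cut-off at [X t w]. The duality function is at most [B],
   and by the vacuum case the cut-off has mean [phi M]. *)
have approx M : `|m - phi M * w0| <= B * (1 - phi M).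
  have bfT := truncated_duality_bounded_borel sigma_gt0 (k := k) M.
  pose vac : 'rV[nat]_L := const_mx 0%N.
  have vac0 : particles vac = 0%N by rewrite /particles big1// => i _;
    rewrite mxE.
  have vacE y : truncated_duality (sigma := sigma) (k := k) M y vac =
      bump 0 (M - tail_energy y 0).
    by rewrite /truncated_duality duality_function_vacuum// mulr1.
  have rvphi : bounded_rv (fun w => bump 0 (M - tail_energy (X t w) 0)).
    by rewrite -(funext (fun w => vacE (X t w)));
      exact: (bounded_borel_rv markovX t_ge0 (bfT _ vac)).
  have meanphi : mean (P x) (fun w => bump 0 (M - tail_energy (X t w) 0)) = phi
    M.
    transitivity (semigroup X P t
        (fun y => truncated_duality (sigma := sigma) (k := k) M y vac) x).
      by rewrite (funext vacE).
    rewrite (truncated_duality_semigroup sigma_gt0 k_gt0 X_ABEP M x_ge0 Y_SIP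
      vac0 t_ge0).
    rewrite (_ : shell_duality _ _ = (fun eta => (particles eta == particles
      vac)%:R)).
      by rewrite (SIP_particles_conserved Y_SIP)// mulr1.
    apply/funext => eta; rewrite /shell_duality vac0.
    by case: eqP => [/(duality_function_vacuum sigma x GN0) ->|_];
      rewrite ?mulr1 ?mul0r.
  have rvT := bounded_borel_rv markovX t_ge0 (bfT _ xi).
  rewrite -(truncated_duality_semigroup sigma_gt0 k_gt0 X_ABEP M x_ge0 Y_SIP
    erefl t_ge0).
  rewrite semigroupE /m -meanB// -meanphi -[X in _ * (X - _)](mean_cst (P x)).
  rewrite -meanB//; last exact: bounded_rv_cst.
  have rv1 : bounded_rv (fun w => 1 - bump 0 (M - tail_energy (X t w) 0)).
    by apply: bounded_rvB => //; exact: bounded_rv_cst.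
  rewrite -meanZ//; apply: ler_norm_mean; [exact: bounded_rvB|exact:
    bounded_rvZ|].
  move=> w; rewrite /truncated_duality; set a := bump _ _;
    set b := duality_function _ _ _ _.
  have /andP[b0 bB] : 0 <= b <= B by apply: HB => //;
    exact: (markov_state markovX).
  have a1 : a <= 1 by exact: bump0_le1.
  rewrite (_ : b - a * b = b * (1 - a)); last by ring.
  by rewrite ger0_norm ?mulr_ge0 ?subr_ge0// ler_wpM2r// subr_ge0.
apply/eqP; rewrite -subr_eq0 -normr_le0; apply/ler_addgt0Pr => e e0;
  rewrite add0r.
(* With [M] exceeding the energy of [x] by [N], the defect [1 - phi M] is at most [N^-1], and the
   total error is at most [(B + |w0|) / N], hence at most [e]. The added 1 keeps [N] positive. *)
pose N := (B + `|w0| + 1) / e.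
have N0 : 0 < N by rewrite divr_gt0// ltr_wpDl// addr_ge0.
have phi1 : phi (tail_energy x 0 + N) <= 1 by exact: bump0_le1.
have phiN : 1 - phi (tail_energy x 0 + N) <= N^-1.
  by rewrite lerBlDr -lerBlDl /phi addrAC subrr add0r; exact: bump0_ge.
have -> : m - w0 = m - phi (tail_energy x 0 + N) * w0 -
    (1 - phi (tail_energy x 0 + N)) * w0 by ring.
rewrite (le_trans (ler_normB _ _))// normrM [`|1 - _|]ger0_norm ?subr_ge0//.
apply: (@le_trans _ _ ((B + `|w0|) * N^-1)).
  rewrite [leRHS]mulrDl lerD//; last by rewrite mulrC ler_wpM2l.
  by rewrite (le_trans (approx _))// ler_wpM2l.
rewrite /N invf_div mulrA ler_pdivrMr ?ltr_wpDl ?addr_ge0// mulrC ler_pM2l//.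
by rewrite lerDl.
Qed.
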